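(* Fix integers $n \geq 1$ and $\ell \geq 1$, and let $\mathscr{F}$ be a family of number fields $K/\mathbb{Q}$ of degree $n$. Fix a real number $\alpha \geq 1$. Suppose that there is an infinite increasing sequence of real numbers $k_1 < k_2 < \cdots$ with $k_j \geq 1$ and $k_j \to \infty$ such that for each $j$ there exists a finite positive constant $c_{n,\ell,k_j,\alpha}$ with \[ \sum_{K \in \mathscr{F}(X)} |\mathrm{Cl}_K[\ell]|^{k_j} \leq c_{n,\ell,k_j,\alpha}\, |\mathscr{F}(X)|^{\alpha} \quad \text{for all } X \geq 1. \] Then for every $\varepsilon>0$ there exists a constant $c_\varepsilon = c(\varepsilon,n,\ell,\alpha)$ such that every field $K \in \mathscr{F}$ satisfies $|\mathrm{Cl}_K[\ell]| \leq c_\varepsilon D_K^{\varepsilon}$.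
   Context: All number fields lie in a fixed algebraic closure $\overline{\mathbb{Q}}$. For a number field $K$, $D_K = |\mathrm{Disc}\, K/\mathbb{Q}|$ is the absolute value of its discriminant, $\mathrm{Cl}_K$ is its ideal class group (written additively), and $\mathrm{Cl}_K[\ell] = \{[\mathfrak{a}] \in \mathrm{Cl}_K : \ell[\mathfrak{a}] = 0\}$ is its $\ell$-torsion subgroup. A family $\mathscr{F}$ is a set of degree $n$ extensions $K/\mathbb{Q}$ (for instance all of them, or those whose Galois closure has a fixed Galois group, possibly with further local or ramification conditions), and for $X \geq 1$, $\mathscr{F}(X)$ denotes the set of $K \in \mathscr{F}$ with $0 < D_K \leq X$. *)

(* Defs.v *)
From HB Require Import structures.
From mathcomp Require Import all_boot all_order all_algebra all_field.
From mathcomp Require Import all_classical all_reals all_analysis.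

Set Implicit Arguments.
Unset Strict Implicit.
Unset Printing Implicit Defensive.

Import Order.TTheory GRing.Theory Num.Theory.
Import numFieldNormedType.Exports.

Local Open Scope classical_set_scope.
Local Open Scope ring_scope.

(** Number fields are subfields of [algC], the library's algebraic closure of
    the rationals; subfields, lattices and ideals are all [set algC]. *)

(** [w] is a basis of [M] with coefficients in [A], which acts on [algC]
    through [f]: every element of [M] is [\sum_i f (c_i) * w_i] for a unique
    coefficient vector [c], and all such sums lie in [M]. *)
Definition is_basis (A : Type) (f : A -> algC) (M : set algC) (n : nat)
    (w : 'I_n -> algC) : Prop :=
  set_bij [set: 'rV[A]_n] M (fun c => \sum_i f (c ord0 i) * w i).

Definition Qbasis := is_basis (ratr : rat -> algC).

Definition Zbasis := is_basis (intr : int -> algC).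

Definition number_field (n : nat) (K : set algC) : Prop :=
  GRing.divring_closed [in K] /\ exists b : 'I_n -> algC, Qbasis K b.

Definition ring_of_integers (K : set algC) : set algC :=
  [set x | K x /\ x \in Aint].

(** The trace from [K] to the rationals: the trace of the matrix of
    multiplication by [x] in a rational basis of [K]; it does not depend on
    the basis. *)
Definition field_trace (K : set algC) (x : algC) : rat :=
  xget 0 [set t : rat | exists (n : nat) (b : 'I_n -> algC) (M : 'M[rat]_n),
    [/\ Qbasis K b,
        forall i, x * b i = \sum_j ratr (M i j) * b j
      & t = \tr M]].

(** The discriminant: [det (Tr (w_i w_j))] for an integral basis [w]; it does
    not depend on the basis. *)
Definition discriminant (K : set algC) : int :=
  xget 0 [set d : int | exists (n : nat) (w : 'I_n -> algC),
    Zbasis (ring_of_integers K) w /\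
    d%:~R = \det (\matrix_(i, j) field_trace K (w i * w j)) :> rat].

Definition absdisc (K : set algC) : nat := `|discriminant K|%N.

Definition scale_set (a : algC) (I : set algC) : set algC :=
  [set a * x | x in I].

Definition fractional_ideal (K I : set algC) : Prop :=
  [/\ I `<=` K,
      (exists2 x, I x & x != 0),
      (forall x y, I x -> I y -> I (x + y)),
      (forall r x, ring_of_integers K r -> I x -> I (r * x))
    & exists d, [/\ ring_of_integers K d, d != 0
                  & scale_set d I `<=` ring_of_integers K]].

Definition ideal_mul (I J : set algC) : set algC :=
  [set x | exists (m : nat) (a b : 'I_m -> algC),
    [/\ forall i, I (a i), forall i, J (b i) & x = \sum_i a i * b i]].

(** The ideal class of [I] is its coset [{aI : a in K^*}] modulo principal
    fractional ideals; the class group consists of all the cosets, with the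
    usual addition of cosets induced by multiplication of ideals. *)
Definition ideal_class (K I : set algC) : set (set algC) :=
  [set scale_set a I | a in [set a | K a /\ a != 0]].

Definition class_group (K : set algC) : set (set (set algC)) :=
  [set ideal_class K I | I in fractional_ideal K].

Definition class_zero (K : set algC) : set (set algC) :=
  ideal_class K (ring_of_integers K).

Definition class_add (C1 C2 : set (set algC)) : set (set algC) :=
  [set ideal_mul I J | I in C1 & J in C2].

Definition class_muln (K : set algC) (l : nat) (C : set (set algC)) :
    set (set algC) :=
  iter l (class_add C) (class_zero K).

Definition class_torsion (K : set algC) (l : nat) : set (set (set algC)) :=
  [set C | class_group K C /\ class_muln K l C = class_zero K].

Definition family_upto (R : realType) (F : set (set algC)) (X : R) :
    set (set algC) :=
  [set K | F K /\ 0 < ((absdisc K)%:R : R) <= X].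

(** Cardinality with values in the extended reals: infinite sets have
    cardinality [+oo], so no default value is involved. *)
Definition ecard (R : realType) (T : choiceType) (A : set T) : \bar R :=
  counting A.

(* Main.v *)
(* Put [X = D_K] in the hypothesis: all the terms of the sum but the one of [K] may
   be dropped, so that [|Cl_K[l]|^k_j <= c_j |F(D_K)|^alpha].  The number of fields of
   degree [n] and discriminant at most [D] is at most [C * D^B], with [C] and [B]
   depending only on [n], hence [|Cl_K[l]| <= (c_j C^alpha)^(1/k_j) D_K^(B alpha/k_j)],
   and it remains to take [j] with [B alpha <= eps k_j].

   The polynomial bound follows from the geometry of numbers: by Minkowski's theorem
   on linear forms, [K] has a rational basis made of integers all of whose conjugates
   are [O(D_K)].  Each of these is a root of a monic polynomial of degree [n] with
   integer coefficients that are polynomially bounded in [D_K], and [K] is the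
   rational span of the basis. *)
Require Import Defs.
From HB Require Import structures.
From mathcomp Require Import all_boot all_order all_fingroup all_algebra all_field.
From mathcomp Require Import all_classical all_reals all_analysis.
From mathcomp Require Import lra ring zify.

Set Implicit Arguments.
Unset Strict Implicit.
Unset Printing Implicit Defensive.

Import Order.TTheory GRing.Theory Num.Theory.
Import numFieldNormedType.Exports.

Local Open Scope classical_set_scope.
Local Open Scope ring_scope.

(** Smallness of conjugates does not by itself give a basis: short integers of [K] may all lie in a
    proper subfield. Independence is forced by asking, for each embedding, for an integer at which
    the corresponding real form is large and every other form is tiny, so that the matrix of forms
    is diagonally dominant. Since any polynomial dependence on [D_K] suffices, constants are crude:
    the linear forms theorem comes from a pigeonhole over the integers, at the cost of a factor
    [n! 2^n], and the square root of [D_K] is replaced by [D_K]. Trace and discriminant are choices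
    made by [xget], so suitable bases must be exhibited before these choices carry any information;
    conjugates then provide formulas for both. The count covers all fields of degree [n] at once,
    which makes the final constant uniform in the family. *)

(** * Linear forms *)

(* Smith normal form identifies [Z^n / A Z^n] with a product of cyclic groups, so
   it has order [|det A|]; two points of the box with side lengths [m j] then
   differ by an element of the lattice spanned by the rows of [A]. *)
Lemma int_pigeonhole n (A : 'M[int]_n) (m : 'I_n -> nat) :
  (`|\det A| < \prod_j m j)%N ->
  exists2 x : 'rV[int]_n, x != 0 & forall j, (`|(x *m A) ord0 j| < m j)%N.
Proof.
move=> ltAm; have [L uL [U uU [d _ defA]]] := int_Smith_normal_form A.
set D := \matrix_(i, j) _ in defA.
have Ddiag (t : 'rV[int]_n) j : (t *m D) ord0 j = t ord0 j * d`_j.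
  rewrite !mxE (bigD1 j) //= mxE eqxx big1 ?addr0 // => i.
  by rewrite mxE -val_eqE => /negPf->; rewrite mulr0.
have detD : `|\det A|%N = (\prod_(i < n) `|(d`_i)%R|)%N.
  have abs_unit (V : 'M[int]_n) : V \in unitmx -> `|\det V|%N = 1%N.
    by rewrite unitmxE => /orP[] /eqP->.
  rewrite defA !det_mulmx !abszM (abs_unit L) // (abs_unit U) // mul1n muln1.
  rewrite (_ : D = diag_mx (\row_i d`_i)); last first.
    by apply/matrixP=> i j; rewrite !mxE.
  rewrite det_diag (big_morph absz abszM absz1).
  by apply: eq_bigr => i _; rewrite mxE.
have LVneq0 (t : 'rV[int]_n) : t != 0 -> t *m invmx L != 0.
  by apply: contraNneq => /(congr1 (mulmx^~ L)); rewrite mulmxKV // mul0mx => ->.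
have m_gt0 j : (0 < m j)%N.
  rewrite lt0n; apply/eqP => mj0; move: ltAm.
  by rewrite (bigD1 j) //= mj0 mul0n.
(* A zero invariant factor, possibly the default value past the end of [d], yields a nonzero integer
   vector killed by [A]. *)
have [/existsP[i /eqP d0]|] := boolP [exists i : 'I_n, d`_i == 0].
  exists (delta_mx ord0 i *m invmx L) => [|j].
    by apply: LVneq0; apply/eqP => /rowP/(_ i); rewrite !mxE !eqxx.
  rewrite defA !mulmxA mulmxKV // (_ : _ *m D = 0) ?mul0mx ?mxE //.
  apply/rowP=> k; rewrite Ddiag !mxE eqxx /=.
  by case: eqP => [->|_]; rewrite ?mul0r // d0 mulr0.
rewrite negb_exists => /forallP d_neq0.
have ltmod (z : int) (i : 'I_n) : (`|(z %% d`_i)%Z| < `|(d`_i)%R|)%N.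
  by rewrite -ltz_nat gez0_abs ?modz_ge0 ?ltz_mod.
(* [v f] is a point of the box and [g f] its class modulo the row lattice: in the coordinates given
   by [invmx U] this lattice is that of [D], so the class is a tuple of residues. *)
pose v (f : fprod (fun i => 'I_(m i))) : 'rV[int]_n := \row_i (f i : nat)%:Z.
pose g f := [fprod i => Ordinal (ltmod ((v f *m invmx U) ord0 i) i)].
have /injectivePn[f [f' neq_ff' eq_g]] : ~~ injectiveb g.
  apply/injectiveP => /leq_card; rewrite !card_fprod.
  rewrite (eq_bigr m) => [|i _]; last by rewrite card_ord.
  rewrite [leqRHS](eq_bigr (fun i : 'I_n => `|(d`_i)%R|%N)) => [|i _]; last by rewrite card_ord.
  by rewrite -detD leqNgt ltAm.
pose y := v f - v f'; pose t := \row_i ((y *m invmx U) ord0 i %/ d`_i)%Z.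
have def_y : y = t *m D *m U.
  suff -> : t *m D = y *m invmx U by rewrite mulmxKV.
  apply/rowP=> i; rewrite Ddiag [t _ _]mxE divzK // /y mulmxBl.
  have /(congr1 val) : g f i = g f' i by rewrite eq_g.
  rewrite !fprodE /= => eq_gi.
  rewrite [fun_of_matrix (_ - _) _ _]mxE [fun_of_matrix (- _) _ _]mxE.
  rewrite -eqz_mod_dvd -[X in X == _]gez0_abs ?modz_ge0 //.
  by rewrite eq_gi gez0_abs ?modz_ge0.
have yE j : y ord0 j = (f j : nat)%:Z - (f' j : nat)%:Z by rewrite !mxE.
exists (t *m invmx L) => [|j].
  apply: LVneq0; apply: contraNneq neq_ff' => t0.
  apply/eqP/fprodP => i; apply/val_inj => /=.
  have := yE i; rewrite def_y t0 !mul0mx mxE => /esym/eqP.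
  by rewrite subr_eq0 => /eqP[].
rewrite defA !mulmxA mulmxKV // -def_y yE.
have := ltn_ord (f j); have := ltn_ord (f' j).
move: (nat_of_ord (f j)) (nat_of_ord (f' j)) => a b lbm lam.
rewrite -ltz_nat abszE ltr_norml; apply/andP; split.
  rewrite ltrBrDr addrC; apply: (@lt_le_trans _ _ 0) => //.
  by rewrite subr_lt0 ltz_nat.
by rewrite ltrBlDr -PoszD ltz_nat ltn_addr.
Qed.

Lemma det_bound (R : numDomainType) n (M : 'M[R]_n) (a : R) :
  (forall i j, `|M i j| <= a) -> `|\det M| <= n`!%:R * a ^+ n.
Proof.
move=> Ma; apply: le_trans (ler_norm_sum _ _ _) _.
have -> : n`!%:R * a ^+ n = \sum_(s : 'S_n) a ^+ n.
  by rewrite sumr_const card_Sn mulr_natl.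
apply: ler_sum => s _; rewrite normrM normrX normrN1 expr1n mul1r normr_prod.
rewrite -[X in a ^+ X]card_ord -prodr_const; apply: ler_prod => i _.
by rewrite normr_ge0 Ma.
Qed.

(* The pigeonhole argument applies to [A := floor (N B)], with [N] large; the
   factor [n! 2^n] absorbs the change of determinant, the factor [2] the rounding
   error in the values of the forms. *)
Lemma minkowski_linear_forms (R : archiRealFieldType) n (B : 'M[R]_n) (c : 'I_n -> R) :
  B \in unitmx -> (forall j, 0 < c j) ->
  n`!%:R * 2 ^+ n * `|\det B| < \prod_j c j ->
  exists2 x : 'rV[int]_n, x != 0 &
    forall j, `|(map_mx intr x *m B) ord0 j| <= 2 * c j.
Proof.
move=> uB c_gt0 ltBc; pose b := \sum_i \sum_j `|invmx B i j|.
have b_ge0 : 0 <= b by apply: sumr_ge0 => i _; apply: sumr_ge0.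
have le_b i j : `|invmx B i j| <= b.
  rewrite /b (bigD1 i) //= (bigD1 j) //= -addrA lerDl addr_ge0 //.
    exact: sumr_ge0.
  by apply: sumr_ge0 => k _; apply: sumr_ge0.
pose C := \sum_j c j.
have C_ge0 : 0 <= C by apply: sumr_ge0 => j _; apply: ltW.
pose nr : R := n%:R.
have nr_ge0 : 0 <= nr by apply: ler0n.
(* [leN1] keeps the entries of [1 - N^-1 B^-1 E] below 2, where [E] is the rounding error, whence
   the factor [n! 2^n]; [leN2] and [leN3] make the error in the values of the forms at most
   [c j]. *)
have [N [N_gt0 leN1 leN2 leN3]] : exists N : nat, [/\ (0 < N)%N, nr * b <= N%:R,
    2 * (nr * nr * b) <= N%:R & forall j, 2 * (nr * b * C) <= N%:R * c j].
  pose M := nr * b + 2 * (nr * nr * b) + \sum_j (2 * (nr * b * C) / c j).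
  have s_ge0 j : 0 <= 2 * (nr * b * C) / c j.
    by rewrite divr_ge0 ?mulr_ge0 ?ler0n // ltW.
  have ss_ge0 : 0 <= \sum_j (2 * (nr * b * C) / c j) by apply: sumr_ge0.
  have p1 : 0 <= nr * b by apply: mulr_ge0.
  have p2 : 0 <= nr * nr * b by rewrite !mulr_ge0.
  have M_ge0 : 0 <= M by rewrite /M; lra.
  exists (Num.trunc M).+1; have /andP[_ /ltW] := truncn_itv M_ge0.
  set N' := _%:R => leMN; split => // [||j]; try by move: leMN; rewrite /M; lra.
  rewrite -ler_pdivrMr //; apply: le_trans leMN.
  rewrite /M (bigD1 j) //=; have : 0 <= \sum_(i < n | i != j) (2 * (nr * b * C) / c i).
    by apply: sumr_ge0 => i _.
  by lra.
have Nr_gt0 : 0 < N%:R :> R by rewrite ltr0n.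
pose A : 'M[int]_n := map_mx Num.floor (N%:R *: B).
pose E := N%:R *: B - map_mx intr A.
have E01 i j : 0 <= E i j <= 1.
  rewrite !mxE; have /andP[] := floor_itv (N%:R * B i j).
  by move=> h1; rewrite rmorphD /= => h2; apply/andP; split; lra.
have normE i j : `|E i j| <= 1 by case/andP: (E01 i j) => h1 h2; rewrite ger0_norm.
pose m j := (Num.trunc (N%:R * c j)).+1.
have m_itv j : (m j).-1%:R <= N%:R * c j < (m j)%:R.
  by apply: truncn_itv; rewrite mulr_ge0 // ltW.
have detA : `|\det A|%:~R <= N%:R ^+ n * (n`!%:R * 2 ^+ n * `|\det B|) :> R.
  rewrite intr_norm -det_map_mx.
  have -> : map_mx intr A = N%:R *: (B *m (1%:M - N%:R^-1 *: (invmx B *m E))).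
    rewrite mulmxBr mulmx1 scalerBr -scalemxAr scalerA mulmxA mulmxV // mul1mx.
    by rewrite divff ?gt_eqF // scale1r /E opprB addrC subrK.
  rewrite detZ det_mulmx !normrM normrX normr_nat ler_wpM2l ?exprn_ge0 //.
  rewrite mulrC ler_wpM2r //; apply: det_bound => i j.
  rewrite !mxE; apply: le_trans (ler_normB _ _) _.
  have -> : 2 = 1 + 1 :> R by lra.
  apply: lerD; first by case: eqP => _; rewrite ?normr1 // normr0.
  rewrite normrM normfV normr_nat -ler_pdivlMl ?invr_gt0 // invrK mulr1.
  apply: le_trans leN1; apply: le_trans (ler_norm_sum _ _ _) _.
  rewrite /nr -[X in X%:R]card_ord mulr_natl -sumr_const; apply: ler_sum => k _.
  by rewrite normrM -[b]mulr1; apply: ler_pM.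
have ltAm : (`|\det A| < \prod_j m j)%N.
  rewrite -(ltr_nat R) natr_prod natr_absz; apply: le_lt_trans detA _.
  have := ltBc; rewrite -(ltr_pM2l (exprn_gt0 n Nr_gt0)) => /lt_le_trans; apply.
  rewrite -[X in N%:R ^+ X](card_ord n) -prodr_const -big_split /=.
  apply: ler_prod => i _; have /andP[_ h2] := m_itv i.
  by rewrite mulr_ge0 ?ltW.
have [x x_neq0 xA_lt] := int_pigeonhole ltAm; exists x => // j.
set X := map_mx intr x : 'rV[R]_n; pose v := X *m B.
pose s := \sum_i `|X ord0 i|.
have s_ge0 : 0 <= s by apply: sumr_ge0.
have v_le i : `|v ord0 i| <= c i + s / N%:R.
  rewrite -(ler_pM2l Nr_gt0) mulrDr mulrCA divff ?gt_eqF // mulr1.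
  have -> : N%:R * `|v ord0 i| = `|(map_mx intr (x *m A) + X *m E) ord0 i|.
    rewrite map_mxM -mulmxDr /E addrC subrK -scalemxAr [in RHS]mxE normrM.
    by rewrite normr_nat.
  rewrite mxE; apply: le_trans (ler_normD _ _) _; apply: lerD.
    rewrite mxE; have /andP[h _] := m_itv i; apply: le_trans h.
    by rewrite -intr_norm -natr_absz ler_nat; apply: xA_lt.
  rewrite mxE; apply: le_trans (ler_norm_sum _ _ _) _; apply: ler_sum => k _.
  by rewrite normrM -[leRHS]mulr1 ler_wpM2l.
(* The rounding error [s / N] depends on the unknown size [s] of [x]. Inverting [B] bounds [s] by
   the values of the forms, hence by itself; by [leN2] the coefficient of [s] on the right is at
   most one half. *)
have s_le : s <= nr * b * (C + nr * (s / N%:R)).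
  have XE : X = v *m invmx B by rewrite /v mulmxK.
  have Xle i : `|X ord0 i| <= b * (C + nr * (s / N%:R)).
    rewrite XE mxE; apply: le_trans (ler_norm_sum _ _ _) _.
    have -> : b * (C + nr * (s / N%:R)) = \sum_k (c k + s / N%:R) * b.
      by rewrite -mulr_suml big_split /= sumr_const card_ord -[_ *+ n]mulr_natl mulrC.
    by apply: ler_sum => k _; rewrite normrM; apply: ler_pM.
  rewrite -mulrA /s [X in X * _](_ : nr = #|'I_n|%:R); last by rewrite card_ord.
  by rewrite mulr_natl -sumr_const; apply: ler_sum => i _.
set u := s / N%:R in v_le s_le.
have def_s : s = N%:R * u by rewrite mulrC divfK ?gt_eqF.
have u_ge0 : 0 <= u by rewrite divr_ge0 // ltW.
have h1 := ler_wpM2r u_ge0 leN2; have h2 := leN3 j.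
have : N%:R * u <= N%:R * c j by rewrite -def_s; nra.
rewrite ler_pM2l // => le_u; apply: le_trans (v_le j) _; lra.
Qed.

(** * Conjugates of the elements of a number field *)

(** Inside [algC] the roots of [minCpoly z] generate a normal extension of the rationals; one of its
    automorphisms sends [z] to [r], and it extends to [algC]. *)
Lemma conjugating_aut (z r : algC) : root (minCpoly z) r ->
  exists nu : {rmorphism algC -> algC}, nu z = r.
Proof.
move=> rz; have [q [Dq mon_q] dv_q] := minCpolyP z.
have [s Ds] := closed_field_poly_normal (minCpoly z).
rewrite (monicP (minCpoly_monic z)) scale1r in Ds.
have [L [LC [s1 Ds1 genL]]] := num_field_exists s.
have LC_inA p : map_poly LC (map_poly (in_alg L) p) = map_poly ratr p.
  rewrite -map_poly_comp; apply: eq_map_poly => a.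
  by rewrite /= alg_num_field fmorph_rat.
have DP : map_poly (in_alg L) q = \prod_(x <- s1) ('X - x%:P).
  apply: (map_poly_inj LC); rewrite LC_inA -Dq Ds -Ds1 big_map rmorph_prod /=.
  by apply: eq_bigr => x _; rewrite map_polyXsubC.
have splitL : SplittingField.axiom L.
  exists (map_poly (in_alg L) q); first by apply/polyOver1P; exists q.
  by exists s1; rewrite ?DP ?eqpxx.
pose mL := FieldExt_isSplittingField.Build rat L splitL.
pose Ls : splittingFieldType rat := HB.pack L mL.
have root_s1 x : root (minCpoly z) x -> exists2 y : L, LC y = x & y \in s1.
  by rewrite Ds root_prod_XsubC -Ds1 => /mapP[y s1y ->]; exists y.
have [a Da s1a] := root_s1 z (root_minCpoly z).
have [b Db s1b] := root_s1 r rz.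
have pb : root (minPoly (1%AS : {subfield Ls}) (a : Ls)) (b : Ls).
  have /polyOver1P[m Dm] := minPolyOver (1%AS : {subfield Ls}) (a : Ls).
  rewrite Dm -(fmorph_root LC) LC_inA Db.
  have : root (map_poly ratr m) z.
    by rewrite -LC_inA -Da fmorph_root -Dm; apply: root_minPoly.
  rewrite dv_q => /dvdpP[m' ->]; rewrite rmorphM rootM /= -Dq rz; exact: orbT.
have [x _ xab] := @normalField_root_minPoly rat Ls 1%AS {:Ls}%AS a b
   (subvf _) (normalFieldf _) (memvf _) pb.
pose phi : {rmorphism L -> L} := x.
have [nu Dnu] := extend_algC_subfield_aut LC phi.
by exists nu; rewrite -Db -Da -Dnu; apply: (congr1 LC xab).
Qed.

(** * Rational bases and primitive elements *)

Lemma QbasisP K n (b : 'I_n -> algC) :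
  Qbasis K b <->
  [/\ forall c : 'rV[rat]_n, K (\sum_i ratr (c ord0 i) * b i),
      forall x, K x -> exists c : 'rV[rat]_n, x = \sum_i ratr (c ord0 i) * b i
    & forall c : 'rV[rat]_n, \sum_i ratr (c ord0 i) * b i = 0 -> c = 0].
Proof.
split=> [[bK b_inj b_surj]|[bK b_surj b_inj]]; split.
- by move=> c; apply: bK.
- by move=> x /b_surj[c _ <-]; exists c.
- move=> c c0; apply: b_inj; rewrite ?inE //= c0 big1 // => i _.
  by rewrite mxE rmorph0 mul0r.
- by move=> c _; apply: bK.
- move=> c c' _ _ /= /eqP; rewrite -subr_eq0 -sumrB => /eqP cc'.
  apply/eqP; rewrite -subr_eq0; apply/eqP/b_inj; rewrite -[RHS]cc'.
  by apply: eq_bigr => i _; rewrite !mxE rmorphB /= mulrBl.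
- by move=> x /b_surj[c ->]; exists c.
Qed.

Lemma sum_mulmx_ratr m n (c : 'rV[rat]_m) (A : 'M[rat]_(m, n)) (w : 'I_n -> algC) :
  \sum_i ratr (c ord0 i) * (\sum_j ratr (A i j) * w j) =
  \sum_j ratr ((c *m A) ord0 j) * w j.
Proof.
under eq_bigr do rewrite mulr_sumr.
rewrite exchange_big; apply: eq_bigr => j _.
rewrite mxE rmorph_sum mulr_suml; apply: eq_bigr => i _.
by rewrite rmorphM mulrA.
Qed.

Lemma span_matrix m n (y : 'I_m -> algC) (w : 'I_n -> algC) :
  (forall i, exists c : 'rV[rat]_n, y i = \sum_j ratr (c ord0 j) * w j) ->
  exists A : 'M[rat]_(m, n), forall i, y i = \sum_j ratr (A i j) * w j.
Proof.
move=> /boolp.choice[f yE]; exists (\matrix_(i, j) f i ord0 j) => i.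
by rewrite yE; apply: eq_bigr => j _; rewrite mxE.
Qed.

Lemma row_free_indep m n (y : 'I_m -> algC) (w : 'I_n -> algC) (A : 'M[rat]_(m, n)) :
  (forall c : 'rV[rat]_m, \sum_i ratr (c ord0 i) * y i = 0 -> c = 0) ->
  (forall i, y i = \sum_j ratr (A i j) * w j) -> row_free A.
Proof.
move=> y_free yE; apply: inj_row_free => c cA0; apply: y_free.
under eq_bigr do rewrite yE.
by rewrite sum_mulmx_ratr cA0 big1 // => j _; rewrite mxE rmorph0 mul0r.
Qed.

Lemma indep_le_span m n (y : 'I_m -> algC) (w : 'I_n -> algC) :
  (forall c : 'rV[rat]_m, \sum_i ratr (c ord0 i) * y i = 0 -> c = 0) ->
  (forall i, exists c : 'rV[rat]_n, y i = \sum_j ratr (c ord0 j) * w j) ->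
  (m <= n)%N.
Proof.
move=> y_free /span_matrix[A yE].
by have /eqP <- := row_free_indep y_free yE; apply: rank_leq_col.
Qed.

Lemma sum_delta n (w : 'I_n -> algC) k :
  \sum_i ratr ((delta_mx ord0 k : 'rV[rat]_n) ord0 i) * w i = w k.
Proof.
rewrite (bigD1 k) //= mxE !eqxx rmorph1 mul1r big1 ?addr0 // => i /negPf ik.
by rewrite mxE eqxx ik rmorph0 mul0r.
Qed.

Lemma Qbasis_elem K n (b : 'I_n -> algC) i : Qbasis K b -> K (b i).
Proof.
by case/QbasisP => bK _ _; have := bK (delta_mx ord0 i); rewrite sum_delta.
Qed.

Lemma Qbasis_size K m n (b : 'I_m -> algC) (b' : 'I_n -> algC) :
  Qbasis K b -> Qbasis K b' -> m = n.
Proof.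
move=> Kb Kb'; have /QbasisP[_ s f] := Kb; have /QbasisP[_ s' f'] := Kb'.
apply/eqP; rewrite eqn_leq; apply/andP; split.
  by apply: indep_le_span f _ => i; exact/s'/(Qbasis_elem i Kb).
by apply: indep_le_span f' _ => i; exact/s/(Qbasis_elem i Kb').
Qed.

Lemma number_field_closed n K : number_field n K ->
  [/\ K 1, forall x y, K x -> K y -> K (x - y), forall x y, K x -> K y -> K (x + y),
      forall x y, K x -> K y -> K (x * y)
    & forall q x, K x -> K (ratr q * x)].
Proof.
case=> [[K1 KB KV] [b /QbasisP[bK bs _]]].
have inK x : (x \in [in K]) = (x \in K) by [].
have K1' : K 1 by move: K1; rewrite inK inE.
have KB' x y : K x -> K y -> K (x - y).
  by move=> Kx Ky; have := KB x y; rewrite !inK !inE; apply.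
have KV' x y : K x -> K y -> K (x / y).
  by move=> Kx Ky; have := KV x y; rewrite !inK !inE; apply.
have K0 : K 0 by rewrite -(subrr 1); apply/KB'.
split=> // [x y Kx Ky|x y Kx Ky|q x Kx].
- by rewrite -[y]opprK; apply/KB' => //; rewrite -[- y]add0r; apply/KB'.
- by rewrite -[y]invrK -[y^-1]mul1r; apply/KV' => //; apply/KV'.
- have [c ->] := bs x Kx; have := bK (q *: c); congr (K _).
  by rewrite mulr_sumr; apply: eq_bigr => i _; rewrite mxE rmorphM mulrA.
Qed.

Lemma number_field_horner n K z (p : {poly rat}) :
  number_field n K -> K z -> K (map_poly ratr p).[z].
Proof.
move=> /number_field_closed[K1 _ KD KM KZ] Kz.
elim/poly_ind: p => [|p c IHp].
  by rewrite rmorph0 horner0 -(mul0r 1) -(rmorph0 ratr); apply: KZ.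
rewrite rmorphD rmorphM /= map_polyX map_polyC hornerD hornerM hornerX hornerC.
by apply: (KD); [apply: KM | rewrite -[X in K X]mulr1; apply: KZ].
Qed.

(** A multiple root would also be a root of the derivative. Being conjugate to [z], it has the same
    minimal polynomial, which would then divide a nonzero polynomial of smaller degree. *)
Lemma minCpoly_separable z (r : seq algC) :
  minCpoly z = \prod_(x <- r) ('X - x%:P) -> uniq r.
Proof.
move=> Dr; rewrite -separable_prod_XsubC -Dr unlock.
apply/Pdiv.ClosedField.coprimepP => x rx.
have [q [Dq mon_q] _] := minCpolyP z; have [nu nuz] := conjugating_aut rx.
have [q' [Dq' _] dv_q'] := minCpolyP x.
have eq_q : q' = q.
  have e : map_poly ratr q' = map_poly ratr q :> {poly algC}.
    by rewrite -Dq' -Dq -nuz minCpoly_aut.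
  exact: (map_poly_inj _ e).
rewrite Dq deriv_map -/(root _ x) dv_q' eq_q; apply/negP => /dvdp_leq.
have sz_q : (1 < size q)%N by have := size_minCpoly z; rewrite Dq size_map_poly.
have q'_neq0 : q^`() != 0.
  apply/eqP => /(congr1 (fun p : {poly rat} => p`_(size q).-2)).
  rewrite coef_deriv coef0.
  have -> : (size q).-2.+1 = (size q).-1 by case: (size q) sz_q => [|[]].
  rewrite -lead_coefE (monicP mon_q) => /eqP; rewrite pnatr_eq0.
  by case: (size q) sz_q => [|[]].
by move=> /(_ q'_neq0); rewrite leqNgt lt_size_deriv // monic_neq0.
Qed.

(** The powers of [z] below the degree of its minimal polynomial form a second rational basis of
    [K]; comparing sizes shows that this degree is [n]. *)
Lemma primitive_element n K : number_field n K ->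
  exists (z : algC) (r : 'I_n -> algC),
    [/\ K z, injective r, minCpoly z = \prod_j ('X - (r j)%:P)
      & forall x, K x -> exists c : 'rV[rat]_n, x = \sum_i ratr (c ord0 i) * z ^+ i].
Proof.
move=> nfK; have [_ [b /QbasisP[bK b_span b_free]]] := nfK.
have [z /sig_eqW[a Dz] /sig_eqW[ps Dps]] := algC_PET (codom b).
have Kz : K z.
  have -> : z = \sum_(i < size (codom b)) ratr (a i)%:R * (codom b)`_i.
    by rewrite Dz; apply: eq_bigr => i _; rewrite ratr_nat mulr_natl.
  have [K1 KB KD _ KZ] := number_field_closed nfK.
  have K0 : K 0 by rewrite -(subrr 1); apply: KB.
  elim/big_ind: _ => // i _; apply: (KZ); have := mem_nth 0 (ltn_ord i).
  by case/codomP => k ->; have := bK (delta_mx ord0 k); rewrite sum_delta.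
have [q [Dq mon_q] dv_q] := minCpolyP z.
have [s Ds] := closed_field_poly_normal (minCpoly z).
rewrite (monicP (minCpoly_monic z)) scale1r in Ds.
have sz_q : size q = (size s).+1 by rewrite -(size_prod_XsubC s id) -Ds Dq size_map_poly.
have spanK x : K x -> exists c : 'rV[rat]_(size s), x = \sum_i ratr (c ord0 i) * z ^+ i.
  move=> Kx; have [p ->] : exists p : {poly rat}, x = (map_poly ratr p).[z].
    have [c ->] := b_span x Kx.
    have /boolp.choice[g bE] : forall i, exists p : {poly rat}, b i = (map_poly ratr p).[z].
      by move=> i; have := codom_f b i; rewrite Dps => /mapP[p _ ->]; exists p.
    exists (\sum_i c ord0 i *: g i); rewrite rmorph_sum horner_sum.
    by apply: eq_bigr => i _; rewrite /= map_polyZ hornerZ bE.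
  exists (\row_i (p %% q)`_i); rewrite {1}(divp_eq p q) rmorphD rmorphM /= -Dq.
  rewrite hornerD hornerM [X in _ * X](rootP (root_minCpoly z)) mulr0 add0r.
  rewrite horner_coef size_map_poly.
  have le_s : (size (p %% q)%R <= size s)%N by rewrite -ltnS -sz_q ltn_modp monic_neq0.
  rewrite (big_ord_widen _ (fun i => (map_poly ratr (p %% q))`_i * z ^+ i) le_s).
  rewrite big_mkcond; apply: eq_bigr => i _; rewrite mxE coef_map.
  by case: ltnP => // h; rewrite nth_default // rmorph0 mul0r.
have z_free (c : 'rV[rat]_(size s)) : \sum_i ratr (c ord0 i) * z ^+ i = 0 -> c = 0.
  move=> c0; pose p := \sum_i c ord0 i *: 'X^i : {poly rat}.
  have sz_p : (size p < size q)%N.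
    rewrite sz_q ltnS; apply: leq_trans (size_sum _ _ _) _.
    apply/bigmax_leqP => i _; apply: leq_trans (size_scale_leq _ _) _.
    by rewrite size_polyXn.
  have p_i (i : 'I_(size s)) : p`_i = c ord0 i.
    rewrite coef_sum (bigD1 i) //= coefZ coefXn eqxx mulr1 big1 ?addr0 // => j.
    by rewrite coefZ coefXn -val_eqE eq_sym => /negPf->; rewrite mulr0.
  have /eqP p0 : p == 0.
    apply: contraTT sz_p => p_neq0; rewrite -leqNgt dvdp_leq // -dv_q.
    apply/eqP; rewrite -[RHS]c0 rmorph_sum horner_sum; apply: eq_bigr => i _.
    by rewrite /= map_polyZ map_polyXn hornerZ hornerXn.
  by apply/rowP=> i; rewrite -p_i p0 coef0 mxE.
have def_n : size s = n.
  apply/eqP; rewrite eqn_leq; apply/andP; split.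
    apply: indep_le_span z_free _ => i; apply: b_span.
    by have := number_field_horner 'X^i nfK Kz; rewrite map_polyXn hornerXn.
  apply: indep_le_span b_free _ => i; apply/spanK.
  by have := bK (delta_mx ord0 i); rewrite sum_delta.
have uniq_s := minCpoly_separable Ds.
move: spanK; rewrite def_n => spanK.
exists z, (fun i => s`_i); split => //.
  by move=> i j /eqP; rewrite nth_uniq ?def_n // => /eqP/val_inj.
by rewrite Ds (big_nth 0) def_n big_mkord.
Qed.

(** * Embeddings and matrices of conjugates *)

Definition conj_mx m n (sigma : 'I_n -> {rmorphism algC -> algC})
    (b : 'I_m -> algC) : 'M[algC]_(m, n) := \matrix_(i, j) sigma j (b i).

Definition conj_row n (sigma : 'I_n -> {rmorphism algC -> algC}) (x : algC) :
    'rV[algC]_n := \row_j sigma j x.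

(* [sigma] restricts to the [n] embeddings of [K]; each one is extended to the
   whole of [algC] so that it can be handled as a ring morphism. *)
Definition conjugate_system n K (sigma : 'I_n -> {rmorphism algC -> algC}) : Prop :=
  [/\ forall b : 'I_n -> algC, Qbasis K b -> conj_mx sigma b \in unitmx,
      exists s : 'I_n -> 'I_n, involutive s /\
        forall j x, K x -> (sigma j x)^* = sigma (s j) x
    & exists i0, forall x, K x -> sigma i0 x = x].

Lemma conj_mx_matrix m n p (sigma : 'I_n -> {rmorphism algC -> algC})
    (y : 'I_m -> algC) (b : 'I_p -> algC) (A : 'M[rat]_(m, p)) :
  (forall i, y i = \sum_j ratr (A i j) * b j) ->
  conj_mx sigma y = map_mx ratr A *m conj_mx sigma b.
Proof.
move=> yE; apply/matrixP=> i j; rewrite !mxE yE rmorph_sum.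
by apply: eq_bigr => k _; rewrite !mxE rmorphM /= fmorph_rat.
Qed.

(** For the powers of a primitive element the matrix of conjugates is a Vandermonde matrix with
    distinct nodes. Complex conjugation permutes these nodes because they are the roots of a
    rational polynomial. *)
Lemma conjugate_system_exists n K : number_field n K ->
  exists sigma : 'I_n -> {rmorphism algC -> algC}, conjugate_system K sigma.
Proof.
move=> nfK; have [z [r [Kz r_inj Dr spanK]]] := primitive_element nfK.
have rootP x : reflect (exists j, x = r j) (root (minCpoly z) x).
  rewrite Dr /root horner_prod prodf_seq_eq0.
  apply: (iffP hasP) => [[j _]|[j ->]].
    by rewrite hornerXsubC subr_eq0 => /eqP->; exists j.
  by exists j; rewrite ?mem_index_enum //= hornerXsubC subrr.
have root_r j : root (minCpoly z) (r j) by apply/rootP; exists j.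
pose sigma j := projT1 (cid (conjugating_aut (root_r j))).
have sigma_z j : sigma j z = r j by rewrite /sigma; case: cid.
have sigmaE j (c : 'rV[rat]_n) :
    sigma j (\sum_i ratr (c ord0 i) * z ^+ i) = \sum_i ratr (c ord0 i) * r j ^+ i.
  rewrite rmorph_sum; apply: eq_bigr => i _.
  by rewrite rmorphM rmorphXn /= fmorph_rat sigma_z.
exists sigma; split.
- move=> b Kb; have /QbasisP[_ _ b_free] := Kb.
  have [A bE] := span_matrix (fun i => spanK _ (Qbasis_elem i Kb)).
  rewrite (conj_mx_matrix _ bE) unitmx_mul map_unitmx -row_free_unit.
  rewrite (row_free_indep b_free bE) /=.
  have -> : conj_mx sigma (fun i => z ^+ i) = Vandermonde n (\row_j r j).
    by apply/matrixP=> i j; rewrite !mxE rmorphXn /= sigma_z.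
  rewrite unitmxE det_Vandermonde unitfE; apply/prodf_neq0 => i _.
  apply/prodf_neq0 => j ij; rewrite !mxE subr_eq0; apply/eqP => /r_inj ji.
  by rewrite ji ltnn in ij.
- have conj_root j : root (minCpoly z) (r j)^*.
    have [q [Dq _] _] := minCpolyP z; have := root_r j; rewrite Dq.
    rewrite -(fmorph_root Num.conj) -map_poly_comp.
    by rewrite (eq_map_poly (fmorph_rat Num.conj)).
  have /boolp.choice[s sE] j : exists k, (r j)^* = r k by apply/rootP.
  exists s; split=> [j|j x /spanK[c ->]].
    by apply: r_inj; rewrite -!sE conjCK.
  rewrite !sigmaE rmorph_sum; apply: eq_bigr => i _.
  by rewrite rmorphM rmorphXn /= fmorph_rat sE.
- have /rootP[i0 zE] := root_minCpoly z; exists i0 => x /spanK[c ->].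
  by rewrite sigmaE -zE.
Qed.

(** The criterion that recognises every basis built later: the matrix of conjugates factors through
    the rational matrix expressing [y] in [b], which must then be invertible. *)
Lemma Qbasis_conj K n (sigma : 'I_n -> {rmorphism algC -> algC}) (b y : 'I_n -> algC) :
  Qbasis K b -> (forall i, K (y i)) -> conj_mx sigma y \in unitmx -> Qbasis K y.
Proof.
move=> /QbasisP[bK b_span b_free] Ky uy.
have [A yE] := span_matrix (fun i => b_span _ (Ky i)).
have uA : A \in unitmx.
  by move: uy; rewrite (conj_mx_matrix _ yE) unitmx_mul map_unitmx => /andP[].
have sumE (c : 'rV[rat]_n) :
    \sum_i ratr (c ord0 i) * y i = \sum_j ratr ((c *m A) ord0 j) * b j.
  by rewrite -sum_mulmx_ratr; apply: eq_bigr => i _; rewrite yE.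
apply/QbasisP; split=> [c|x /b_span[c ->]|c].
- by rewrite sumE.
- by exists (c *m invmx A); rewrite sumE mulmxKV.
- by rewrite sumE => /b_free /(congr1 (mulmx^~ (invmx A))); rewrite mulmxK // mul0mx.
Qed.

(** The embeddings diagonalise multiplication by [x]; traces and characteristic polynomials are read
    off from this form. *)
Lemma conj_mul_matrix n (sigma : 'I_n -> {rmorphism algC -> algC}) (b : 'I_n -> algC)
    x (M : 'M[rat]_n) :
  (forall i, x * b i = \sum_j ratr (M i j) * b j) -> conj_mx sigma b \in unitmx ->
  map_mx ratr M = conj_mx sigma b *m diag_mx (conj_row sigma x) *m invmx (conj_mx sigma b).
Proof.
move=> /(conj_mx_matrix sigma) ME ub; rewrite -(mulmxK ub (map_mx ratr M)) -ME.
congr (_ *m _); apply/matrixP=> i j; rewrite mxE rmorphM mulrC.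
rewrite mxE (bigD1 j) //= !mxE eqxx mulr1n big1 ?addr0 // => k /negPf kj.
by rewrite !mxE kj mulr0n mulr0.
Qed.

Lemma mul_matrix_exists n K (b : 'I_n -> algC) x : number_field n K -> Qbasis K b -> K x ->
  exists M : 'M[rat]_n, forall i, x * b i = \sum_j ratr (M i j) * b j.
Proof.
move=> nfK Kb Kx; have [_ _ _ KM _] := number_field_closed nfK.
have /QbasisP[_ b_span _] := Kb.
by apply: span_matrix => i; apply/b_span/KM => //; exact: Qbasis_elem Kb.
Qed.

(** The characteristic polynomial of multiplication by [x] works even when [x] generates a proper
    subfield, where conjugates are repeated. *)
Lemma conj_char_poly n K (sigma : 'I_n -> {rmorphism algC -> algC}) x :
  number_field n K -> conjugate_system K sigma -> K x ->
  exists p : {poly rat}, map_poly ratr p = \prod_j ('X - (sigma j x)%:P).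
Proof.
move=> nfK [uK _ _] Kx; have [_ [b Kb]] := nfK; have ub := uK b Kb.
have [M ME] := mul_matrix_exists nfK Kb Kx; exists (char_poly M).
rewrite map_char_poly (conj_mul_matrix ME ub).
set S := conj_mx sigma b in ub *; set D := diag_mx _.
have SV : map_mx polyC S *m map_mx polyC (invmx S) = 1%:M.
  by rewrite -map_mxM mulmxV // map_mx1.
have eqM : char_poly_mx (S *m D *m invmx S) =
    map_mx polyC S *m char_poly_mx D *m map_mx polyC (invmx S).
  rewrite /char_poly_mx mulmxBr mulmxBl !map_mxM scalar_mxC.
  by rewrite -[X in _ = X - _]mulmxA SV mulmx1.
rewrite /char_poly eqM !det_mulmx mulrAC -det_mulmx SV det1 mul1r.
have -> : char_poly_mx D = diag_mx (\row_j ('X - (sigma j x)%:P)).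
  apply/matrixP=> i j; rewrite !mxE.
  by case: eqP => _ //=; rewrite ?mulr1n // !mulr0n subrr.
by rewrite det_diag; apply: eq_bigr => j _; rewrite mxE.
Qed.

(** * Integral bases and the discriminant *)

(** [xget] selects a value computed in some basis of some size [m]; [Qbasis_size] forces [m = n],
    and the diagonal form gives the same trace in every basis. *)
Lemma field_traceE n K (sigma : 'I_n -> {rmorphism algC -> algC}) x :
  number_field n K -> conjugate_system K sigma -> K x ->
  ratr (field_trace K x) = \sum_j sigma j x.
Proof.
move=> nfK [uK _ _] Kx; rewrite /field_trace; set T := [set t : rat | _].
have [_ [b Kb]] := nfK; have [M ME] := mul_matrix_exists nfK Kb Kx.
have : T (xget 0 T) by apply: (@xgetPex _ 0 T); exists (\tr M), n, b, M.
case=> m [b' [M' [Kb' ME' ->]]]; have Dm := Qbasis_size Kb' Kb.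
case: _ / Dm b Kb M ME sigma uK b' Kb' M' ME' => b Kb M ME sigma uK b' Kb' M' ME'.
rewrite -(trace_map_mx ratr) (conj_mul_matrix ME' (uK _ Kb')) mxtrace_mulC mulmxA.
rewrite mulVmx ?uK // mul1mx mxtrace_diag.
by apply: eq_bigr => j _; rewrite mxE.
Qed.

Lemma det_trace_form m n K (sigma : 'I_n -> {rmorphism algC -> algC}) (w : 'I_m -> algC) :
  number_field n K -> conjugate_system K sigma -> (forall i, K (w i)) ->
  map_mx ratr (\matrix_(i, j) field_trace K (w i * w j)) =
    conj_mx sigma w *m (conj_mx sigma w)^T.
Proof.
move=> nfK sK Kw; have [_ _ _ KM _] := number_field_closed nfK.
apply/matrixP=> i j; rewrite !mxE (field_traceE nfK sK (KM _ _ (Kw i) (Kw j))).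
by apply: eq_bigr => k _; rewrite !mxE rmorphM.
Qed.

Lemma denominator (x : algC) : exists2 N : nat, (0 < N)%N & N%:R * x \in Aint.
Proof.
have [q [_ /monic_neq0 q_neq0] dv_q] := minCpolyP x.
have [p [a a_neq0 Dq]] := rat_poly_scale q.
have p_neq0 : p != 0 by apply: contraNneq q_neq0 => p0; rewrite Dq p0 rmorph0 scaler0.
have px : root (map_poly intr p) x.
  have : root (map_poly ratr q) x by rewrite dv_q.
  rewrite Dq map_polyZ /= rootZ; last by rewrite fmorph_eq0 invr_eq0 intr_eq0.
  by rewrite -map_poly_comp (eq_map_poly (ratr_int _)).
set c := lead_coef p; have c_neq0 : c != 0 by rewrite lead_coef_eq0.
have cx : c%:~R * x \in Aint.
  have sz_p : (1 < size p)%N.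
    rewrite -(size_map_inj_poly (@intr_inj algC) (rmorph0 _)).
    by apply: root_size_gt1 px; rewrite map_poly_eq0_id0 // intr_eq0.
  have [d Dd] : exists d, size p = d.+2.
    by exists (size p).-2; case: (size p) sz_p => [|[]].
  (* Chosen so that [r(c x) = c^d p(x)], with [p] of degree [d + 1] and leading coefficient [c]. *)
  pose r : {poly int} := 'X^(d.+1) + \poly_(i < d.+1) (p`_i * c ^+ (d - i)).
  apply: (@root_monic_Aint (map_poly intr r)).
  - rewrite /root rmorphD /= map_polyXn hornerD hornerXn.
    have -> : map_poly intr (\poly_(i < d.+1) (p`_i * c ^+ (d - i))) =
        \poly_(i < d.+1) (p`_i * c ^+ (d - i))%:~R :> {poly algC}.
      by apply/polyP=> i; rewrite coef_map !coef_poly; case: ifP; rewrite ?rmorph0.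
    rewrite horner_poly -[X in _ == X](mulr0 (c%:~R ^+ d)) -[X in _ == _ * X](rootP px) horner_coef.
    rewrite size_map_inj_poly ?rmorph0 //; last exact: intr_inj.
    rewrite Dd [X in _ == _ * X]big_ord_recr /= [X in _ == _ * X]addrC mulrDr coef_map /=.
    have -> : p`_d.+1 = c by rewrite /c lead_coefE Dd.
    rewrite mulr_sumr [X in X + _ == _]exprMn [c%:~R ^+ d.+1]exprSr -[X in X + _ == _]mulrA.
    apply/eqP; congr (_ + _); apply: eq_bigr => i _; rewrite coef_map /= rmorphM rmorphXn /= exprMn.
    have le_id : (i <= d)%N by rewrite -ltnS.
    have -> : c%:~R ^+ d = c%:~R ^+ (d - i) * c%:~R ^+ i :> algC by rewrite -exprD subnK.
    by ring.
  - apply: monic_map; rewrite monicE lead_coefDl ?lead_coefXn //.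
    by rewrite size_polyXn ltnS size_poly.
  - by apply/polyOverP=> i; rewrite coef_map /= intr_int.
exists `|c|%N; first by rewrite absz_gt0.
rewrite natr_absz intr_norm.
have /orP[/eqP->|/eqP->] : (`|c%:~R| == c%:~R :> algC) || (`|c%:~R| == - c%:~R :> algC).
  by rewrite -intr_norm; case: (ger0P c) => _; rewrite ?eqxx // rmorphN eqxx orbT.
- by [].
- by rewrite mulNr rpredN.
Qed.

Lemma sum_intr n (c : 'rV[int]_n) (w : 'I_n -> algC) :
  \sum_i (c ord0 i)%:~R * w i = \sum_i ratr ((map_mx intr c : 'rV[rat]_n) ord0 i) * w i.
Proof. by apply: eq_bigr => i _; rewrite mxE ratr_int. Qed.

Lemma clear_denominators n (c : 'rV[rat]_n) :
  exists (N : nat) (z : 'rV[int]_n), (0 < N)%N /\ N%:R *: c = map_mx intr z.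
Proof.
exists (\prod_i `|denq (c ord0 i)|)%N.
exists (\row_i (numq (c ord0 i) * (\prod_(j | j != i) `|denq (c ord0 j)|)%N%:Z)).
split; first by apply: prodn_gt0 => i; rewrite absz_gt0 denq_neq0.
apply/rowP=> i; rewrite !mxE (bigD1 i) //= natrM rmorphM mulrAC; congr (_ * _).
rewrite natr_absz gtr0_norm ?denq_gt0 // mulrC.
by rewrite -{1}[c ord0 i]divq_num_den divfK // intr_eq0 denq_neq0.
Qed.

Lemma ZbasisP n M (w : 'I_n -> algC) :
  Zbasis M w <->
  [/\ forall c : 'rV[int]_n, M (\sum_i (c ord0 i)%:~R * w i),
      forall x, M x -> exists c : 'rV[int]_n, x = \sum_i (c ord0 i)%:~R * w i
    & forall c : 'rV[int]_n, \sum_i (c ord0 i)%:~R * w i = 0 -> c = 0].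
Proof.
split=> [[wM w_inj w_surj]|[wM w_surj w_inj]]; split.
- by move=> c; apply: wM.
- by move=> x /w_surj[c _ <-]; exists c.
- move=> c c0; apply: w_inj; rewrite ?inE //= c0 big1 // => i _.
  by rewrite mxE mul0r.
- by move=> c _; apply: wM.
- move=> c c' _ _ /= /eqP; rewrite -subr_eq0 -sumrB => /eqP cc'.
  apply/eqP; rewrite -subr_eq0; apply/eqP/w_inj; rewrite -[RHS]cc'.
  by apply: eq_bigr => i _; rewrite !mxE rmorphB /= mulrBl.
- by move=> x /w_surj[c ->]; exists c.
Qed.

(** A positive integer multiple brings any element of [K] into the ring of integers, and turns any
    rational relation into an integral one. *)
Lemma Zbasis_Qbasis m n K (w : 'I_m -> algC) : number_field n K ->
  Zbasis (ring_of_integers K) w -> Qbasis K w.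
Proof.
move=> nfK /ZbasisP[wO w_span w_free]; have [K1 KB KD _ KZ] := number_field_closed nfK.
have Kw (c : 'rV[int]_m) : K (\sum_i (c ord0 i)%:~R * w i) by case: (wO c).
have scale (N : nat) (c : 'rV[rat]_m) : N%:R * (\sum_i ratr (c ord0 i) * w i) =
    \sum_i ratr ((N%:R *: c) ord0 i) * w i.
  rewrite mulr_sumr; apply: eq_bigr => i _.
  by rewrite mxE rmorphM /= ratr_nat mulrA.
apply/QbasisP; split=> [c|x Kx|c c0].
- have [N [z [N_gt0 cz]]] := clear_denominators c.
  have := KZ N%:R^-1 _ (Kw z); rewrite sum_intr -cz -scale fmorphV /= ratr_nat mulKf //.
  by rewrite pnatr_eq0 -lt0n.
- have [N N_gt0 Nx] := denominator x.
  have [|z Dz] := w_span (N%:R * x).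
    by split=> //; have := KZ N%:R x Kx; rewrite ratr_nat.
  have N_neq0 : N%:R != 0 :> algC by rewrite pnatr_eq0 -lt0n.
  exists (N%:R^-1 *: map_mx intr z); apply: (mulfI N_neq0).
  by rewrite Dz scale scalerA divff ?scale1r ?sum_intr // pnatr_eq0 -lt0n.
- have [N [z [N_gt0 cz]]] := clear_denominators c.
  have z0 : z = 0 by apply: w_free; rewrite sum_intr -cz -scale c0 mulr0.
  move: cz; rewrite z0 map_mx0 => /eqP; rewrite scaler_eq0 pnatr_eq0 -leqn0.
  by rewrite leqNgt N_gt0 => /eqP.
Qed.

(** The determinant is rational because traces are, and an algebraic integer because it is the
    square of a determinant of conjugates. *)
Lemma disc_int n K (sigma : 'I_n -> {rmorphism algC -> algC}) (w : 'I_n -> algC) :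
  number_field n K -> conjugate_system K sigma ->
  (forall i, ring_of_integers K (w i)) ->
  exists d : int, d%:~R = \det (\matrix_(i, j) field_trace K (w i * w j)) :> rat /\
    d%:~R = \det (conj_mx sigma w) ^+ 2 :> algC.
Proof.
move=> nfK sK Ow; have Kw i : K (w i) by case: (Ow i).
set T := \matrix_(i, j) _.
have DT : ratr (\det T) = \det (conj_mx sigma w) ^+ 2 :> algC.
  by rewrite -det_map_mx (det_trace_form nfK sK Kw) det_mulmx det_tr.
have : ratr (\det T) \in Aint.
  rewrite DT; apply: rpredX; apply: rpred_sum => s _; apply: rpredM.
    by apply: rpredX; rewrite rpredN rpred1.
  by apply: rpred_prod => i _; rewrite mxE Aint_aut; case: (Ow i).
move/(Cint_rat_Aint (Crat_rat _))/intrP => [d Dd]; exists d; split; last by rewrite -DT Dd.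
by apply: (fmorph_inj (ratr : {rmorphism rat -> algC})); rewrite /= ratr_int -Dd.
Qed.

Lemma det_replace_row (R : comNzRingType) n (k : 'I_n) (u : 'rV[R]_n) :
  \det (\matrix_(i, j) (if i == k then u ord0 j else (i == j)%:R)) = u ord0 k.
Proof.
set A := \matrix_(i, j) _; rewrite (expand_det_row A k).
have cof j : cofactor A k j = (j == k)%:R.
  have -> : cofactor A k j = cofactor (1%:M : 'M[R]_n) k j.
    rewrite /cofactor; congr (_ * \det _); apply/matrixP=> i i'.
    by rewrite !mxE [lift k i == k]eq_sym (negPf (neq_lift _ _)).
  have adj1 : \adj (1%:M : 'M[R]_n) = 1%:M.
    by have := mul_mx_adj (1%:M : 'M[R]_n); rewrite mul1mx det1.
  by have := congr1 (fun B : 'M[R]_n => B j k) adj1; rewrite !mxE.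
rewrite (bigD1 k) //= cof eqxx mulr1 big1 ?addr0 ?mxE ?eqxx // => j /negPf jk.
by rewrite cof jk mulr0.
Qed.

Lemma ring_of_integersD n K x y : number_field n K ->
  ring_of_integers K x -> ring_of_integers K y -> ring_of_integers K (x + y).
Proof.
case/number_field_closed => _ _ KD _ _ [Kx Ax] [Ky Ay].
by split; [apply: KD | apply: rpredD].
Qed.

Lemma ring_of_integersZ n K (c : int) x : number_field n K ->
  ring_of_integers K x -> ring_of_integers K (c%:~R * x).
Proof.
case/number_field_closed => _ _ _ _ KZ [Kx Ax]; split.
  by rewrite -ratr_int; apply: KZ.
by apply: rpredM => //; apply: Aint_int.
Qed.

Lemma integral_Qbasis n K : number_field n K ->
  exists b : 'I_n -> algC, Qbasis K b /\ forall i, ring_of_integers K (b i).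
Proof.
move=> nfK; have [sigma [uK sK _]] := conjugate_system_exists nfK.
have [_ [b Kb]] := nfK.
have /boolp.choice[N NP] i : exists N : nat, (0 < N)%N /\ N%:R * b i \in Aint.
  by have [N N_gt0 NA] := denominator (b i); exists N.
have [_ _ _ _ KZ] := number_field_closed nfK.
have KNb i : K ((N i)%:R * b i).
  by have := KZ (N i)%:R _ (Qbasis_elem i Kb); rewrite ratr_nat.
exists (fun i => (N i)%:R * b i); split; last by move=> i; case: (NP i); split.
apply: (Qbasis_conj (sigma := sigma) Kb) => //.
have -> : conj_mx sigma (fun i => (N i)%:R * b i) =
    diag_mx (\row_i (N i)%:R) *m conj_mx sigma b.
  rewrite mul_diag_mx; apply/matrixP=> i j; rewrite !mxE rmorphM /=.
  by rewrite rmorph_nat.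
rewrite unitmx_mul uK // andbT unitmxE det_diag unitfE.
by apply/prodf_neq0 => i _; rewrite mxE pnatr_eq0 -lt0n; case: (NP i).
Qed.

(* If [x] has a non-integral coordinate on [b k], replacing [b k] by [x] minus an
   integer multiple of [b k] multiplies the determinant by the fractional part of
   that coordinate: a basis of minimal discriminant is an integral basis. *)
Lemma integral_basis_step n K (sigma : 'I_n -> {rmorphism algC -> algC}) (b : 'I_n -> algC)
    (c : 'rV[rat]_n) (k : 'I_n) :
  number_field n K -> conjugate_system K sigma ->
  Qbasis K b -> (forall i, ring_of_integers K (b i)) ->
  ring_of_integers K (\sum_i ratr (c ord0 i) * b i) -> c ord0 k \isn't a Num.int ->
  exists (b' : 'I_n -> algC) (f : rat),
    [/\ Qbasis K b', forall i, ring_of_integers K (b' i), 0 < f < 1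
      & \det (conj_mx sigma b') = ratr f * \det (conj_mx sigma b)].
Proof.
move=> nfK sK Kb Ob Ox ck; have [uK _ _] := sK.
set x := \sum_i _ in Ox; pose z := Num.floor (c ord0 k).
pose b' i := if i == k then x - z%:~R * b k else b i.
pose A : 'M[rat]_n := \matrix_(i, j)
  (if i == k then (c - z%:~R *: delta_mx ord0 k) ord0 j else (i == j)%:R).
have b'E i : b' i = \sum_j ratr (A i j) * b j.
  rewrite /b'; case: eqP => [->|/eqP/negPf ik].
    rewrite /x (bigD1 k) //= [RHS](bigD1 k) //= -addrA addrCA addrC; congr (_ + _).
      by rewrite -mulrBl !mxE !eqxx mulr1 rmorphB /= ratr_int.
    by apply: eq_bigr => j /negPf jk; rewrite !mxE eqxx jk mulr0 subr0.
  rewrite (bigD1 i) //= big1 => [|j /negPf ji]; rewrite !mxE ik ?eqxx.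
    by rewrite rmorph1 mul1r addr0.
  by rewrite eq_sym ji rmorph0 mul0r.
have detb' : \det (conj_mx sigma b') = ratr (c ord0 k - z%:~R) * \det (conj_mx sigma b).
  rewrite (conj_mx_matrix sigma b'E) det_mulmx det_map_mx det_replace_row.
  by rewrite !mxE !eqxx mulr1.
have f01 : 0 < c ord0 k - z%:~R < 1.
  have /andP[h1 h2] := floor_itv (c ord0 k); rewrite -/z in h1 h2.
  rewrite rmorphD rmorph1 in h2; apply/andP; split; last by rewrite ltrBlDl.
  rewrite subr_gt0 lt_neqAle h1 andbT.
  by apply: contraNneq ck => <-; exact: intr_int.
have Ob' i : ring_of_integers K (b' i).
  rewrite /b'; case: eqP => // _; rewrite -mulNr -rmorphN.
  by apply: (ring_of_integersD nfK) => //; apply: (ring_of_integersZ _ nfK).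
exists b', (c ord0 k - z%:~R); split=> //.
apply: (Qbasis_conj (sigma := sigma) Kb) => [i|]; first by case: (Ob' i).
have det_neq0 : \det (conj_mx sigma b) != 0 by rewrite -unitfE -unitmxE uK.
rewrite unitmxE detb' unitfE; apply: mulf_neq0 => //.
by rewrite fmorph_eq0 gt_eqF //; case/andP: f01.
Qed.

Lemma integral_basis n K : number_field n K ->
  exists w : 'I_n -> algC, Zbasis (ring_of_integers K) w.
Proof.
move=> nfK; have [sigma sK] := conjugate_system_exists nfK.
have [b [Kb Ob]] := integral_Qbasis nfK.
have [d [_ Dd]] := disc_int nfK sK Ob.
have [m] := ubnP `|d|%N; elim: m => // m IHm in b Kb Ob d Dd *; rewrite ltnS => le_dm.
have /QbasisP[_ b_span b_free] := Kb.
have [[c [k [Ox ck]]]|all_int] := pselect (exists (c : 'rV[rat]_n) k,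
  ring_of_integers K (\sum_i ratr (c ord0 i) * b i) /\ c ord0 k \isn't a Num.int).
  have [b' [f [Kb' Ob' /andP[f0 f1] Db']]] := integral_basis_step nfK sK Kb Ob Ox ck.
  have [d' [_ Dd']] := disc_int nfK sK Ob'.
  apply: (IHm b' Kb' Ob' d' Dd'); apply: leq_trans le_dm.
  have d_neq0 : d != 0.
    rewrite -(intr_eq0 (algC : numDomainType)) Dd sqrf_eq0 -unitfE -unitmxE.
    by case: sK => uK _ _; apply: uK.
  (* The discriminant is the square of the determinant, so it shrinks by [f ^+ 2 < 1] and the
     descent terminates. *)
  have Dd'' : d'%:~R = f ^+ 2 * d%:~R :> rat.
    apply: (fmorph_inj (ratr : {rmorphism rat -> algC})) => /=.
    by rewrite rmorphM rmorphXn /= !ratr_int Dd Dd' Db' exprMn.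
  rewrite -(ltr_nat rat) !natr_absz !intr_norm Dd'' normrM.
  rewrite -[ltRHS]mul1r ltr_pM2r ?normr_gt0 ?intr_eq0 // ger0_norm ?exprn_ge0 ?ltW //.
  by rewrite expr_lt1 // ltW.
exists b; apply/ZbasisP; split=> [c|x Ox|c].
- have := nfK; case/number_field_closed => K1 KB _ _ _.
  have O0 : ring_of_integers K 0.
    by split; [rewrite -(subrr (1 : algC)); apply: KB | apply: rpred0].
  elim/big_ind: _ => // [x y|i _]; first exact: ring_of_integersD nfK.
  exact: ring_of_integersZ nfK _.
- have [c Dx] := b_span x (proj1 Ox).
  exists (map_mx Num.floor c); rewrite sum_intr Dx; apply: eq_bigr => i _; rewrite !mxE.
  suff /floorK -> : c ord0 i \is a Num.int by [].
  apply/negPn/negP => ci; apply: all_int; exists c, i; split => //.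
  by rewrite -Dx.
- rewrite sum_intr => /b_free/rowP c0; apply/rowP=> i.
  by have := c0 i; rewrite !mxE => /eqP; rewrite intr_eq0 => /eqP.
Qed.

(** The basis returned is the one behind the choice made in [discriminant]; the existence of an
    integral basis rules out the default value of [xget]. *)
Lemma discriminant_det n K (sigma : 'I_n -> {rmorphism algC -> algC}) :
  number_field n K -> conjugate_system K sigma ->
  exists w : 'I_n -> algC, Zbasis (ring_of_integers K) w /\
    (discriminant K)%:~R = \det (conj_mx sigma w) ^+ 2.
Proof.
move=> nfK sK; rewrite /discriminant; set T := [set d : int | _].
have O_elem m (w : 'I_m -> algC) : Zbasis (ring_of_integers K) w ->
    forall i, ring_of_integers K (w i).
  move=> /ZbasisP[wO _ _] i; have := wO (delta_mx ord0 i).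
  by rewrite sum_intr map_delta_mx sum_delta.
have : T (xget 0 T).
  apply: xgetPex; have [w Ow] := integral_basis nfK.
  have [d [Dd _]] := disc_int nfK sK (O_elem _ _ Ow); by exists d, n, w.
case=> m [w [Ow Dw]]; have [_ [b Kb]] := nfK.
have Dm := Qbasis_size (Zbasis_Qbasis nfK Ow) Kb; subst m.
exists w; split=> //; have [d [Dd <-]] := disc_int nfK sK (O_elem _ _ Ow).
congr _%:~R; apply: (@intr_inj rat); by rewrite Dw Dd.
Qed.

(** * Bases with small conjugates *)

(** A vector killed by the transpose, examined at its coordinate of largest modulus, contradicts the
    dominance of that row. *)
Lemma diag_dominant (F : realFieldType) n (G : 'M[F]_n) :
  (forall i, \sum_(j | j != i) `|G i j| < `|G i i|) -> G \in unitmx.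
Proof.
move=> domG; rewrite -unitmx_tr -row_free_unit; apply: inj_row_free => v vG0.
apply/eqP; apply: contraT => v_neq0.
have [i0 vi0] : exists i, v ord0 i != 0 by apply/rV0Pn.
pose i := [arg max_(i > i0) `|v ord0 i|]%O.
have max_i j : `|v ord0 j| <= `|v ord0 i|.
  by rewrite /i; case: Order.TotalTheory.arg_maxP => // k _; apply.
have vi_gt0 : 0 < `|v ord0 i| by apply: lt_le_trans (max_i i0); rewrite normr_gt0.
have := congr1 (fun u : 'rV_n => u ord0 i) vG0; rewrite !mxE (bigD1 i) //= mxE.
move/eqP; rewrite addr_eq0 => /eqP/(congr1 Num.norm); rewrite normrN normrM => eqi.
have : `|v ord0 i| * `|G i i| <= `|v ord0 i| * \sum_(j | j != i) `|G i j|.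
  rewrite eqi mulr_sumr; apply: le_trans (ler_norm_sum _ _ _) _.
  by apply: ler_sum => j _; rewrite mxE normrM ler_wpM2r.
by rewrite ler_pM2l // leNgt domG.
Qed.

Lemma reim_real (z : algC) : 'Re z + 'Im z \is Num.real.
Proof. by rewrite rpredD ?Creal_Re ?Creal_Im. Qed.

(* The forms [Re (sigma j x) + Im (sigma j x)], for all [j], are a real system
   equivalent to the [n] embeddings, without choosing one embedding in each pair of
   complex conjugates: the two members of a pair give [Re + Im] and [Re - Im]. *)
Definition reim (z : algC) : algR := in_algR (reim_real z).

Lemma reimE z : algRval (reim z) = (1 - 'i) / 2 * z + (1 + 'i) / 2 * z^*.
Proof. by rewrite /= ReE ImE; field. Qed.

Lemma reim_bound z : `|z| <= algRval (`|reim z| + `|reim z^*|).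
Proof.
pose a := in_algR (Creal_Re z); pose b := in_algR (Creal_Im z).
have -> : reim z = a + b by apply: val_inj.
have -> : reim z^* = a - b by apply: val_inj; rewrite /= Re_conj Im_conj.
apply: (@le_trans _ _ (algRval (`|a| + `|b|))).
  rewrite {1}[z]Crect; apply: le_trans (ler_normD _ _) _.
  by rewrite normrM normCi mul1r.
suff : `|a| + `|b| <= `|a + b| + `|a - b| by [].
have h1 : `|(a + b) + (a - b)| <= `|a + b| + `|a - b| by apply: ler_normD.
have h2 : `|(a + b) - (a - b)| <= `|a + b| + `|a - b| by apply: ler_normB.
have e1 : (a + b) + (a - b) = 2 * a by ring.
have e2 : (a + b) - (a - b) = 2 * b by ring.
by move: h1 h2; rewrite e1 e2 !normrM !normr_nat; lra.
Qed.

(** Column [j] writes the [j]-th form in terms of the embedding [j] and its complex conjugate [s j].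
    When [s j = j] the two coefficients add up to 1. *)
Definition reim_mx n (s : 'I_n -> 'I_n) : 'M[algC]_n :=
  \matrix_(k, j) ((1 - 'i) / 2 * (k == j)%:R + (1 + 'i) / 2 * (k == s j)%:R).

Lemma reim_conj_mx m n K (sigma : 'I_n -> {rmorphism algC -> algC}) (y : 'I_m -> algC)
    (s : 'I_n -> 'I_n) :
  (forall j x, K x -> (sigma j x)^* = sigma (s j) x) -> (forall i, K (y i)) ->
  map_mx algRval (\matrix_(i, j) reim (sigma j (y i))) = conj_mx sigma y *m reim_mx s.
Proof.
move=> sE Ky; apply/matrixP=> i j; rewrite 2!mxE [RHS]mxE.
rewrite (eq_bigr (fun k => (1 - 'i) / 2 * (conj_mx sigma y i k * (k == j)%:R) +
   (1 + 'i) / 2 * (conj_mx sigma y i k * (k == s j)%:R))); last first.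
  by move=> k _; rewrite [reim_mx _ _ _]mxE; ring.
have pick (l : 'I_n) : \sum_k conj_mx sigma y i k * (k == l)%:R = sigma l (y i).
  rewrite (bigD1 l) //= eqxx mulr1 mxE big1 ?addr0 // => k /negPf->.
  by rewrite mulr0.
by rewrite big_split -!mulr_sumr !pick reimE sE.
Qed.

(* The change of forms is unitary. *)
Lemma det_reim_mx n (s : 'I_n -> 'I_n) : involutive s -> `|\det (reim_mx s)| = 1.
Proof.
move=> sK; set Q := reim_mx s.
(* [Q] is symmetric since [s] is an involution, so entrywise conjugation gives the adjoint. In the
   product, the coefficient of [P] is [((1 - 'i) / 2)^2 + ((1 + 'i) / 2)^2 = 0]. *)
have QQ : Q *m map_mx Num.conj Q = 1%:M.
  pose P : 'M[algC]_n := \matrix_(k, j) (k == s j)%:R.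
  have PP : P *m P = 1%:M.
    apply/matrixP=> k l; rewrite !mxE (bigD1 (s l)) //= !mxE sK eqxx mulr1.
    by rewrite big1 ?addr0 // => j /negPf jl; rewrite !mxE jl mulr0.
  have -> : Q = ((1 - 'i) / 2)%:M + ((1 + 'i) / 2) *: P.
    by apply/matrixP=> k j; rewrite !mxE mulr_natr.
  have -> : map_mx Num.conj (((1 - 'i) / 2)%:M + ((1 + 'i) / 2) *: P) =
      ((1 + 'i) / 2)%:M + ((1 - 'i) / 2) *: P :> 'M[algC]_n.
    rewrite map_mxD map_scalar_mx map_mxZ /=.
    have -> : ((1 - 'i) / 2)^* = (1 + 'i) / 2 :> algC.
      by rewrite rmorphM fmorphV rmorphB /= conjCi rmorph1 rmorph_nat opprK.
    have -> : ((1 + 'i) / 2)^* = (1 - 'i) / 2 :> algC.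
      by rewrite rmorphM fmorphV rmorphD /= conjCi rmorph1 rmorph_nat.
    by congr (_ + _ *: _); apply/matrixP=> k j; rewrite !mxE rmorph_nat.
  rewrite mulmxDl !mulmxDr -!scalemxAl -!scalemxAr PP !mul_scalar_mx !mul_mx_scalar.
  have i2 : 'i * 'i = -1 :> algC by rewrite -expr2 sqrCi.
  apply/matrixP=> k l; rewrite !mxE.
  by case: (k == l); case: (k == s l); rewrite ?mulr1n ?mulr0n; field: i2.
have := congr1 determinant QQ; rewrite det_mulmx det1 det_map_mx -normCK => /eqP.
by rewrite sqrp_eq1 // => /eqP.
Qed.

(** Up to sign the product of the conjugates is the constant term of a rational polynomial; it is
    also an algebraic integer, hence a nonzero rational integer. *)
Lemma norm_ge1 n K (sigma : 'I_n -> {rmorphism algC -> algC}) x :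
  number_field n K -> conjugate_system K sigma -> ring_of_integers K x -> x != 0 ->
  1 <= \prod_j `|sigma j x|.
Proof.
move=> nfK sK [Kx Ax] x_neq0; have [p Dp] := conj_char_poly nfK sK Kx.
have Np : ratr p.[0] = \prod_j - sigma j x.
  rewrite -(horner_map (ratr : {rmorphism rat -> algC})) /= Dp horner_prod rmorph0.
  by apply: eq_bigr => j _; rewrite hornerXsubC sub0r.
have -> : \prod_j `|sigma j x| = `|ratr p.[0]| :> algC.
  by rewrite Np normr_prod; apply: eq_bigr => j _; rewrite normrN.
apply: norm_intr_ge1; last first.
  by rewrite Np; apply/prodf_neq0 => j _; rewrite oppr_eq0 fmorph_eq0.
apply: Cint_rat_Aint; first exact: Crat_rat.
by rewrite Np; apply: rpred_prod => j _; rewrite rpredN Aint_aut.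
Qed.

Lemma absdisc_gt0 n K : number_field n K -> (0 < absdisc K)%N.
Proof.
move=> nfK; have [sigma sK] := conjugate_system_exists nfK.
have [w [Ow Dw]] := discriminant_det nfK sK.
rewrite absz_gt0 -(intr_eq0 (algC : numDomainType)) Dw sqrf_eq0 -unitfE -unitmxE.
by case: sK => uK _ _; apply/uK/(Zbasis_Qbasis nfK Ow).
Qed.

(** [n! 2^n] is the loss in the linear forms theorem. Of the factor [(8n)^(n+1)], [n - 1] powers
    compensate the small forms, of size [1/(8n)], and the other two make the inequality strict. *)
Definition conj_bound (n : nat) : nat := (n`! * 2 ^ n * (8 * n) ^ n.+1)%N.

Lemma conj_bound_gt0 n : (0 < n)%N -> (0 < conj_bound n)%N.
Proof. by move=> n_gt0; rewrite !muln_gt0 fact_gt0 !expn_gt0 muln_gt0 n_gt0. Qed.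

(* All the forms but the [i]-th are small, so the [i]-th one is not, since a nonzero
   integer has norm at least 1. *)
Lemma skew_integer n K (sigma : 'I_n -> {rmorphism algC -> algC}) (i : 'I_n) :
  number_field n K -> conjugate_system K sigma ->
  exists2 x, ring_of_integers K x &
    [/\ forall j, j != i -> `|reim (sigma j x)| <= (4 * n%:R)^-1,
        4^-1 < `|reim (sigma i x)|
      & `|reim (sigma i x)| <= (2 * (conj_bound n * absdisc K))%:R].
Proof.
move=> nfK sK; have [uK [s [s_inv sE]] _] := sK.
have [w [Ow Dw]] := discriminant_det nfK sK; have Kw := Zbasis_Qbasis nfK Ow.
have n_gt0 : (0 < n)%N by case: n i {sigma sK uK s s_inv sE w Ow Dw Kw nfK} => [[]|].
pose B : 'M[algR]_n := \matrix_(k, j) reim (sigma j (w k)).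
have BE : map_mx algRval B = conj_mx sigma w *m reim_mx s.
  by apply: (reim_conj_mx sE) => k; apply: Qbasis_elem Kw.
have detB : algRval `|\det B| = `|\det (conj_mx sigma w)|.
  have -> : algRval `|\det B| = `|algRval (\det B)| by [].
  by rewrite -det_map_mx BE det_mulmx normrM det_reim_mx // mulr1.
have uB : B \in unitmx.
  rewrite unitmxE unitfE -normr_gt0.
  have : 0 < algRval `|\det B| by rewrite detB normr_gt0 -unitfE -unitmxE uK.
  by [].
have detB_sqr : `|\det B| ^+ 2 = (absdisc K)%:R.
  have e1 : algRval (`|\det B| ^+ 2) = algRval `|\det B| ^+ 2 by apply: rmorphXn.
  have e2 m : algRval m%:R = m%:R by apply: rmorph_nat.
  apply: val_inj; apply: etrans e1 _; apply: etrans (esym (e2 _)).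
  by rewrite detB -normrX -Dw -intr_norm -natr_absz.
have D_gt0 : (0 < absdisc K)%N := absdisc_gt0 nfK.
have D_ge1 : 1 <= (absdisc K)%:R :> algR by rewrite ler1n.
have detB_le : `|\det B| <= (absdisc K)%:R.
  by have := normr_ge0 (\det B); move: detB_sqr; nra.
(* The theorem on linear forms doubles the bounds: [d] becomes [1/(4n)], small enough for the
   off-diagonal entries of a row to add up to at most [1/4]. *)
pose d : algR := (8 * n%:R)^-1; pose C : algR := (conj_bound n * absdisc K)%:R.
have nR_ge1 : 1 <= n%:R :> algR by rewrite ler1n.
have d_gt0 : 0 < d by rewrite invr_gt0; lra.
have C_gt0 : 0 < C.
  by rewrite ltr0n muln_gt0 D_gt0 conj_bound_gt0.
have [||x x_neq0 xB] := @minkowski_linear_forms _ n B (fun j => if j == i then C else d) uB.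
- by move=> j; case: ifP.
- rewrite (bigD1 i) //= eqxx (eq_bigr (fun=> d)) => [|j /negPf->//].
  have prod_d : \prod_(j < n | j != i) d = d ^+ n / d.
    rewrite -[X in d ^+ X](card_ord n) -prodr_const [in RHS](bigD1 i) //=.
    by rewrite mulrAC divff ?mul1r ?gt_eqF.
  set N : algR := n`!%:R * 2 ^+ n.
  have -> : C = N * d^-1 ^+ n.+1 * (absdisc K)%:R.
    by rewrite /C /N /d invrK /conj_bound !natrM !natrX !natrM.
  have -> : N * d^-1 ^+ n.+1 * (absdisc K)%:R * \prod_(j < n | j != i) d =
      N * (absdisc K)%:R * (d^-1 * d^-1).
    rewrite prod_d exprVn exprS; move: (d) (d_gt0) => e e_gt0.
    have := exprn_gt0 n e_gt0; move: (e ^+ n) => en en_gt0.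
    by field; rewrite !gt_eqF.
  have N_gt0 : 0 < N by rewrite mulr_gt0 ?exprn_gt0 ?ltr0n ?fact_gt0.
  rewrite -mulrA ltr_pM2l //; apply: le_lt_trans detB_le _.
  rewrite invrK -[ltLHS]mulr1 ltr_pM2l; last lra.
  by nra.
pose y := \sum_k (x ord0 k)%:~R * w k.
have /ZbasisP[wO _ w_free] := Ow.
have Oy : ring_of_integers K y by apply: wO.
have y_neq0 : y != 0 by apply: contra_neq x_neq0; apply: w_free.
have yB j : reim (sigma j y) = (map_mx intr x *m B) ord0 j.
  have val_sum (F : 'I_n -> algR) : algRval (\sum_k F k) = \sum_k algRval (F k).
    exact: (rmorph_sum algRval).
  have valM (u v : algR) : algRval (u * v) = algRval u * algRval v by [].
  have val_int (z : int) : algRval z%:~R = z%:~R by apply: (rmorph_int algRval).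
  apply: val_inj; apply: etrans (reimE _) _.
  rewrite mxE; apply: etrans (esym (val_sum _)).
  rewrite /y !rmorph_sum !mulr_sumr -big_split.
  apply: eq_bigr => k _; rewrite valM !mxE reimE val_int !rmorphM /= !rmorph_int.
  by ring.
exists y => //; split.
- move=> j ji; rewrite yB; apply: le_trans (xB j) _; rewrite (negPf ji) /d.
  by rewrite le_eqVlt; apply/orP; left; apply/eqP; field; rewrite gt_eqF // ltr0n.
(* Otherwise all forms are at most [1/4]. Two forms control each conjugate, so every conjugate is at
   most [1/2] and the norm is less than 1. *)
- rewrite ltNge; apply/negP => le4.
  have le_all j : `|reim (sigma j y)| <= 4^-1.
    have [->//|ji] := eqVneq j i; rewrite yB; apply: le_trans (xB j) _.
    rewrite (negPf ji) /d; have : (8 * n%:R)^-1 <= 8^-1 :> algR.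
      by rewrite lef_pV2 ?posrE; lra.
    by lra.
  have le_half j : `|sigma j y| <= 2^-1.
    apply: le_trans (reim_bound _) _; rewrite sE; last by case: Oy.
    have -> : 2^-1 = algRval 2^-1 by rewrite fmorphV (rmorph_nat algRval).
    have h1 := le_all j; have h2 := le_all (s j).
    suff : `|reim (sigma j y)| + `|reim (sigma (s j) y)| <= 2^-1 by [].
    by lra.
  have := norm_ge1 nfK sK Oy y_neq0.
  have h : \prod_j `|sigma j y| <= \prod_(j < n) 2^-1.
    by apply: ler_prod => j _; rewrite normr_ge0 le_half.
  move=> /le_trans/(_ h); rewrite prodr_const card_ord => ge1.
  have lt1 : (2^-1 : algC) ^+ n < 1.
    by rewrite exprn_ilt1 ?invr_ge0 ?ler0n -?lt0n // invf_lt1 ?ltr1n ?ltr0n.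
  by have := le_lt_trans ge1 lt1; rewrite ltxx.
- by rewrite yB; apply: le_trans (xB i) _; rewrite eqxx natrM.
Qed.

(* The forms evaluated at the [n] skew integers give a diagonally dominant matrix. *)
Lemma small_Qbasis n K (sigma : 'I_n -> {rmorphism algC -> algC}) :
  number_field n K -> conjugate_system K sigma ->
  exists x : 'I_n -> algC, [/\ Qbasis K x, forall i, ring_of_integers K (x i)
    & forall i j, `|sigma j (x i)| <= (4 * (conj_bound n * absdisc K))%:R].
Proof.
move=> nfK sK; have [uK [s [s_inv sE]] _] := sK.
have /boolp.choice[x xP] i : exists x, ring_of_integers K x /\
    [/\ forall j, j != i -> `|reim (sigma j x)| <= (4 * n%:R)^-1,
        4^-1 < `|reim (sigma i x)|
      & `|reim (sigma i x)| <= (2 * (conj_bound n * absdisc K))%:R].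
  by have [x Ox xP] := skew_integer i nfK sK; exists x.
have Ox i : ring_of_integers K (x i) by case: (xP i).
have Kx i : K (x i) by case: (Ox i).
have [_ [b Kb]] := nfK.
exists x; split=> //.
  apply: (Qbasis_conj (sigma := sigma) Kb) => //.
  have : map_mx algRval (\matrix_(i, j) reim (sigma j (x i))) \in unitmx.
    rewrite map_unitmx; apply: diag_dominant => i; rewrite mxE.
    have n_gt0 := leq_ltn_trans (leq0n i) (ltn_ord i).
    have [_ [offd diag _]] := xP i; apply: le_lt_trans diag.
    (* Adding a term for the diagonal position makes the bound exactly [n * (4n)^-1 = 1/4]. *)
    apply: (@le_trans _ _ (\sum_(j < n) (4 * n%:R)^-1)); last first.
      rewrite sumr_const card_ord -[_ *+ n]mulr_natl le_eqVlt; apply/orP; left.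
      by apply/eqP; field; rewrite gt_eqF // ltr0n.
    rewrite [leRHS](bigD1 i) //= -[leLHS]add0r; apply: lerD.
      by rewrite invr_ge0 mulr_ge0 ?ler0n.
    by apply: ler_sum => j ji; rewrite mxE offd.
  by rewrite (reim_conj_mx sE) // unitmx_mul => /andP[].
move=> i j; have n_gt0 := leq_ltn_trans (leq0n i) (ltn_ord i).
apply: le_trans (reim_bound _) _; rewrite sE //.
have le_T k : `|reim (sigma k (x i))| <= (2 * (conj_bound n * absdisc K))%:R.
  have [_ [offd diag le_i]] := xP i; have [->//|ki] := eqVneq k i.
  apply: le_trans (offd k ki) _.
  have n_ge1 : 1 <= n%:R :> algR by rewrite ler1n.
  apply: (@le_trans _ _ 1); first by rewrite invf_le1; lra.
  have := conj_bound_gt0 n_gt0; have := absdisc_gt0 nfK.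
  by rewrite ler1n; move: (conj_bound n) => u; rewrite !muln_gt0 => -> ->.
rewrite -(rmorph_nat algRval).
suff : `|reim (sigma j (x i))| + `|reim (sigma (s j) (x i))| <=
    (4 * (conj_bound n * absdisc K))%:R by [].
by have := le_T j; have := le_T (s j); rewrite !natrM; lra.
Qed.

(** * Counting fields of bounded discriminant *)

(** Multiplying by ['X - a] shifts the coefficients and subtracts [a] times the old ones, so the
    bound grows by a factor of at most [1 + T]. *)
Lemma coef_prod_XsubC_bound (R : numDomainType) (s : seq R) (T : R) (i : nat) :
  0 <= T -> (forall a, a \in s -> `|a| <= T) ->
  `|(\prod_(a <- s) ('X - a%:P))`_i| <= (1 + T) ^+ size s.
Proof.
move=> T_ge0; elim: s i => [|a s IHs] i sT.
  by rewrite big_nil coef1; case: eqP; rewrite ?normr1 // normr0.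
have sT' b : b \in s -> `|b| <= T by move=> bs; apply: sT; rewrite inE bs orbT.
rewrite big_cons mulrBl coefB coefXM coefCM exprS mulrDl mul1r.
apply: le_trans (ler_normB _ _) _; apply: lerD.
  case: eqP => _; first by rewrite normr0 exprn_ge0 // addr_ge0.
  exact: IHs.
by rewrite normrM; apply: ler_pM => //; [apply: sT; rewrite mem_head | apply: IHs].
Qed.

Lemma conj_int_poly n K (sigma : 'I_n -> {rmorphism algC -> algC}) x :
  number_field n K -> conjugate_system K sigma -> ring_of_integers K x ->
  exists p : {poly int}, map_poly intr p = \prod_j ('X - (sigma j x)%:P).
Proof.
move=> nfK sK [Kx Ax]; have [p Dp] := conj_char_poly nfK sK Kx.
set Q := \prod_j _ in Dp *; exists (map_poly Num.floor Q); apply: floorpK.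
have /polyOverP QA : Q \is a polyOver Aint.
  by apply: rpred_prod => j _; rewrite polyOverXsubC Aint_aut.
apply/polyOverP=> i; apply: Cint_rat_Aint => //.
by rewrite -Dp coef_map Crat_rat.
Qed.

(* [f i] encodes the coefficient [f i - H], which ranges over [-H, H]. *)
Definition coef_poly n H (f : {ffun 'I_n -> 'I_(2 * H).+1}) : {poly algC} :=
  'X^n + \sum_(i < n) ((f i : nat)%:R - H%:R) *: 'X^i.

(** [t.1] codes a monic polynomial of degree [n], and [t.2] is a position in its list of [n]
    roots. *)
Definition root_decode n H (t : {ffun 'I_n -> 'I_(2 * H).+1} * 'I_n) : algC :=
  (sval (closed_field_poly_normal (coef_poly t.1)))`_(t.2).

Lemma root_decode_surj n H (p : {poly int}) x :
  size p = n.+1 -> p \is monic -> (forall i, `|p`_i| <= H%:Z) ->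
  root (map_poly intr p) x -> exists t : {ffun 'I_n -> 'I_(2 * H).+1} * 'I_n, root_decode t = x.
Proof.
move=> sz_p mon_p le_pH px.
pose f : {ffun 'I_n -> 'I_(2 * H).+1} :=
  [ffun i : 'I_n => inord (absz (p`_i + H%:Z))].
have fE (i : 'I_n) : (f i : nat)%:R - H%:R = (p`_i)%:~R :> algC.
  have /ler_normlP[h1 h2] := le_pH i.
  have h3 : 0 <= p`_i + H%:Z by rewrite -lerBlDr sub0r lerNl.
  rewrite ffunE inordK; last first.
    by rewrite ltnS -lez_nat gez0_abs // mul2n -addnn PoszD lerD2r.
  by rewrite natr_absz ger0_norm // rmorphD /= addrK.
have Df : coef_poly f = map_poly intr p.
  rewrite -[p in RHS]coefK sz_p poly_def big_ord_recr /= rmorphD addrC.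
  have -> : p`_n = 1 by have := monicP mon_p; rewrite lead_coefE sz_p.
  rewrite scale1r /= map_polyXn; congr (_ + _); rewrite rmorph_sum.
  by apply: eq_bigr => i _; rewrite fE /= map_polyZ /= map_polyXn.
have Dr := svalP (closed_field_poly_normal (coef_poly f)).
set r := sval _ in Dr; have mon_f : coef_poly f \is monic by rewrite Df monic_map.
rewrite (monicP mon_f) scale1r in Dr.
have xr : x \in r by rewrite -root_prod_XsubC -Dr Df.
have sz_r : size r = n.
  apply/eqP; rewrite -eqSS -(size_prod_XsubC r id) -Dr Df.
  by rewrite size_map_inj_poly ?rmorph0 ?sz_p //; apply: intr_inj.
have lt_xn : (index x r < n)%N by rewrite -sz_r index_mem.
by exists (f, Ordinal lt_xn); apply: nth_index.
Qed.

Definition rat_span n (b : 'I_n -> algC) : set algC :=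
  [set x | exists c : 'rV[rat]_n, x = \sum_i ratr (c ord0 i) * b i].

(** The range of the coefficients is the bound of [coef_prod_XsubC_bound] for [n] conjugates of size
    at most [4 * (conj_bound n * D)]. A field may have many codes; one is enough for an upper
    bound. *)
Lemma number_field_decode n K D : number_field n K -> (absdisc K <= D)%N ->
  exists t : {ffun 'I_n -> {ffun 'I_n -> 'I_(2 * (1 + 4 * (conj_bound n * D)) ^ n).+1} * 'I_n},
    rat_span (fun i => root_decode (t i)) = K.
Proof.
move=> nfK leD; have [sigma sK] := conjugate_system_exists nfK.
have [x [Kx Ox x_le]] := small_Qbasis nfK sK.
set H := (_ ^ n)%N.
have /boolp.choice[t tE] i : exists t : {ffun 'I_n -> 'I_(2 * H).+1} * 'I_n, root_decode t = x i.
  have [p Dp] := conj_int_poly nfK sK (Ox i).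
  have inj_intr : injective (intr : int -> algC) by apply: intr_inj.
  apply: (@root_decode_surj n H p).
  - have := size_map_inj_poly inj_intr (rmorph0 _) p; rewrite Dp => <-.
    by rewrite size_prod_XsubC /index_enum -enumT size_enum_ord.
  - have : map_poly (intr : int -> algC) p \is monic by rewrite Dp monic_prod_XsubC.
    by rewrite !monicE lead_coef_map_inj ?rmorph0 // => /eqP h; apply/eqP/inj_intr; rewrite h.
  - move=> k; rewrite -(ler_int algC) intr_norm /=.
    have -> : (p`_k)%:~R = (map_poly intr p)`_k :> algC by rewrite coef_map.
    rewrite Dp -(big_map (fun j => sigma j (x i)) xpredT (fun a => 'X - a%:P)).
    apply: le_trans (coef_prod_XsubC_bound (T := (4 * (conj_bound n * D))%:R) _ _ _) _.
    + exact: ler0n.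
    + move=> _ /mapP[j _ ->]; apply: le_trans (x_le i j) _.
      by rewrite ler_nat !leq_mul2l leD !orbT.
    + by rewrite size_map /index_enum -enumT size_enum_ord -[X in X + _]/(1%:R) -natrD -natrX.
  - rewrite Dp; have [_ _ [i0 si0]] := sK.
    rewrite /root horner_prod; apply/prodf_eq0; exists i0 => //.
    by rewrite hornerXsubC si0 ?subrr //; case: (Ox i).
exists (finfun t); rewrite (_ : (fun i => _) = x); last first.
  by apply/funext => i; rewrite ffunE.
have /QbasisP[xK x_span _] := Kx.
by rewrite eqEsubset; split=> [_ [c ->]|y /x_span].
Qed.

Lemma number_field_count n : exists C B : nat, forall D : nat, (0 < D)%N ->
  exists (T : finType) (g : T -> set algC), (#|T| <= C * D ^ B)%N /\
    forall K, number_field n K -> (absdisc K <= D)%N -> exists t, g t = K.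
Proof.
pose c := (1 + 4 * conj_bound n)%N.
(* There are [n] generators, each with [n] coefficients and a root index. Each coefficient takes
   [2H + 1 <= 3 (c D)^n] values, so [D] occurs to the power [n^3]. *)
exists (((3 * c ^ n) ^ n * n) ^ n)%N, (n * n * n)%N => D D_gt0.
pose H := ((1 + 4 * (conj_bound n * D)) ^ n)%N.
pose T : finType := {ffun 'I_n -> {ffun 'I_n -> 'I_(2 * H).+1} * 'I_n}.
exists T, (fun t : T => rat_span (fun i => root_decode (t i))); split; last first.
  by move=> K nfK leD; apply: number_field_decode.
have leX a b e : (a <= b -> a ^ e <= b ^ e)%N by case: e => // e; rewrite leq_exp2r.
rewrite !(card_ffun, card_prod, card_ord) /H !expnM -expnMn; apply: (leX).
rewrite mulnAC leq_mul2r -expnMn; apply/orP; right; apply: (leX).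
have le_c : (1 + 4 * (conj_bound n * D) <= c * D)%N.
  by rewrite /c mulnDl mul1n mulnA leq_add2r.
have := leX _ _ n le_c; rewrite expnMn.
have : (0 < (c * D) ^ n)%N by rewrite expn_gt0 muln_gt0 D_gt0.
by rewrite expnMn; lia.
Qed.

(** * From the count of fields to the torsion bound *)

Lemma ecard_image_le (R : realType) (U : choiceType) (T : finType) (g : T -> U) (A : set U) :
  (forall x, A x -> exists t, g t = x) -> (ecard R A <= (#|T|%:R)%:E)%E.
Proof.
move=> Ag; have finA : finite_set A.
  apply: (@sub_finite_set _ _ (g @` [set: T])) => [x /Ag[t <-]|]; first by exists t.
  by apply: finite_image; apply: finite_finset.
rewrite /ecard /counting asboolT // lee_fin ler_nat cardE.
rewrite -(size_map g); apply: uniq_leq_size; first exact: finmap.fset_uniq.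
move=> x; rewrite in_fset_set // inE => /Ag[t <-].
by rewrite map_f // mem_enum.
Qed.

Lemma ecard_ge0 (R : realType) (U : choiceType) (A : set U) : (0 <= ecard R A)%E.
Proof. by rewrite /ecard /counting; case: ifP => _; rewrite ?leey // lee_fin. Qed.

Lemma esum_ge_term (R : realType) (U : choiceType) (A : set U) (f : U -> \bar R) x :
  A x -> (f x <= \esum_(y in A) f y)%E.
Proof.
move=> Ax; apply: esum_ge; exists [set x]; last by rewrite fsbig_set1.
by split; [exact: finite_set1 | move=> _ ->].
Qed.

Theorem theorem1p1 (R : realType) (n l : nat) (hn : (1 <= n)%N) (hl : (1 <= l)%N)
    (alpha : R) (halpha : 1 <= alpha)
    (k : nat -> R) (hk_incr : forall i j : nat, (i < j)%N -> k i < k j)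
    (hk_ge1 : forall j, 1 <= k j) (hk_lim : k j @[j --> \oo] --> +oo)
    (c : nat -> R) (hc : forall j, 0 < c j)
    (eps : R) (heps : 0 < eps) :
  exists c_eps : R, forall F : set (set algC),
    (forall K, F K -> number_field n K) ->
    (forall (j : nat) (X : R), 1 <= X ->
       (\esum_(K in family_upto F X) (ecard R (class_torsion K l) `^ k j)
          <= (c j)%:E * ecard R (family_upto F X) `^ alpha)%E) ->
    forall K, F K ->
      (ecard R (class_torsion K l) <= (c_eps * (absdisc K)%:R `^ eps)%:E)%E.
Proof.
have [C [B countP]] := number_field_count n.
have [j le_kj] : exists j, B%:R * alpha / eps <= k j.
  have /cvgryPge/(_ (B%:R * alpha / eps))[j _ le_k] := hk_lim.
  by exists j; apply: le_k => /=.
have kj_gt0 : 0 < k j by apply: lt_le_trans (hk_ge1 j).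
have alpha_ge0 : 0 <= alpha by apply: le_trans halpha.
(* The index [j] and the constants [C] and [B] are all fixed before [F] is introduced. *)
exists ((c j * C%:R `^ alpha) `^ (k j)^-1) => F nfF sumF K FK.
have nfK := nfF K FK; have D_gt0 := absdisc_gt0 nfK.
set D := absdisc K in D_gt0 *; have D_ge1 : 1 <= D%:R :> R by rewrite ler1n.
have FDK : family_upto F (D%:R : R) K by split=> //; rewrite ltr0n D_gt0 lexx.
have [T [g [cardT gP]]] := countP D D_gt0.
have cardF : (ecard R (family_upto F (D%:R : R)) <= (C%:R * D%:R ^+ B)%:E)%E.
  apply: (@le_trans _ _ (#|T|%:R)%:E).
    apply: (@ecard_image_le R _ T g) => L [FL /andP[_ leD]].
    by apply: gP; [apply: nfF | rewrite -(ler_nat R)].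
  by rewrite lee_fin -natrX -natrM ler_nat.
set tau := ecard R _; have tau_ge0 : (0 <= tau)%E := ecard_ge0 _ _.
have in_itv (x : \bar R) : (0 <= x)%E -> x \in `[0%E, +oo%E].
  by move=> x_ge0; rewrite in_itv /= x_ge0 leey.
have le_tau : (tau `^ k j <= (c j * (C%:R * D%:R ^+ B) `^ alpha)%:E)%E.
  apply: le_trans (esum_ge_term (fun L => ecard R (class_torsion L l) `^ k j)%E FDK) _.
  apply: le_trans (sumF j _ D_ge1) _.
  rewrite EFinM -poweR_EFin; apply: lee_wpmul2l; first by rewrite lee_fin ltW.
  apply: gt0_ler_poweR => //; apply: in_itv; first exact: ecard_ge0.
  by rewrite lee_fin mulr_ge0 ?exprn_ge0 ?ler0n.
have kjV_ge0 : 0 <= (k j)^-1 by rewrite invr_ge0 ltW.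
(* A priori [tau] may be infinite, so the root of order [k j] is taken in the extended reals;
   finiteness follows from [le_tau]. *)
have -> : tau = ((tau `^ k j) `^ (k j)^-1)%E.
  by rewrite -poweRrM divff ?gt_eqF // poweRe1.
apply: le_trans (gt0_ler_poweR kjV_ge0 _ _ le_tau) _.
- by apply: in_itv; apply: poweR_ge0.
- by apply: in_itv; rewrite lee_fin mulr_ge0 ?powR_ge0 // ltW.
rewrite poweR_EFin lee_fin [X in c j * X]powRM ?exprn_ge0 ?ler0n // mulrA.
rewrite powRM ?powR_ge0 //; last first.
  by rewrite mulr_ge0 ?powR_ge0 // ltW.
rewrite ler_wpM2l ?powR_ge0 // -powR_mulrn ?ler0n // -!powRrM.
by apply: ler_powR => //; rewrite ?mulrA ler_pdivrMr // [leRHS]mulrC -ler_pdivrMr.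
Qed.
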